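(* Let $n\to\infty$, and suppose that the integers $p,q$, the edge set $\mathbf{E}_0$ and the matrix $\Theta_0$ (hence $\sigma^2_{\max},\lambda_{\max},\theta_0$) may vary with $n$, while $C>0$, $\kappa>0$ and $\gamma$ are fixed reals, such that: (i) $\mathbf{E}_0$ is decomposable and $|\mathbf{E}_0|\le q$; (ii) $\sigma^2_{\max}\lambda_{\max}\le C$; (iii) $p=O(n^{\kappa})$ and $p\to\infty$; (iv) $\gamma_0:=\gamma-\left(1-\frac{1}{4\kappa}\right)>0$; (v) $(p+2q)\log p\cdot\frac{\lambda_{\max}^2}{\theta_0^2}=o(n)$. Let $\mathcal{E}_1$ be the set of edge sets $\mathbf{E}$ on the $p$ nodes with $\mathbf{E}\not\supset\mathbf{E}_0$ and $|\mathbf{E}|\le q$. Then with probability tending to $1$ as $n\to\infty$, $$l_n(\Theta_0)-l_n(\hat\Theta(\mathbf{E}))>2q(\log p)(1+\gamma_0)\quad\text{for all }\mathbf{E}\in\mathcal{E}_1.$$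
   Context: An edge set $\mathbf{E}$ on $p$ nodes is a set of unordered pairs $\{j,k\}$ of distinct elements of $\{1,\dots,p\}$; it is identified with the Gaussian graphical model of all zero-mean normal distributions $N(0,\Theta^{-1})$ with $\Theta$ positive definite and $\Theta_{jk}=0$ whenever $j\neq k$ and $\{j,k\}\notin\mathbf{E}$. $\mathbf{E}$ is decomposable if the graph it defines is chordal. Let $\Theta_0$ be a $p\times p$ positive definite matrix whose nonzero entries are exactly the diagonal entries and the entries $(j,k),(k,j)$ for $\{j,k\}\in\mathbf{E}_0$. Let $X_1,\dots,X_n$ be i.i.d. $N(0,\Theta_0^{-1})$, $S=\frac1n\sum_i X_iX_i^T$, and $l_n(\Theta)=\frac n2[\log\det\Theta-\mathrm{trace}(S\Theta)]$. $\hat\Theta(\mathbf{E})$ denotes the maximum likelihood estimator of $\Theta$ in the model $\mathbf{E}$. Further, $\sigma^2_{\max}=\max_j(\Theta_0^{-1})_{jj}$, $\theta_0=\min_{\{j,k\}\in\mathbf{E}_0}|(\Theta_0)_{jk}|$, and $\lambda_{\max}$ is the largest eigenvalue of $\Theta_0$. *)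

(* Defs.v *)
From HB Require Import structures.
From mathcomp Require Import all_boot all_order all_algebra.
From mathcomp Require Import all_classical all_reals all_analysis.
From mathcomp Require Import normal_distribution.
Set Implicit Arguments.
Unset Strict Implicit.
Unset Printing Implicit Defensive.
Import Order.TTheory GRing.Theory Num.Theory.
Local Open Scope classical_set_scope.
Local Open Scope ring_scope.

(* An edge set on p nodes: unordered pairs {j,k}, j <> k, encoded as ordered
   pairs (j,k) with j < k. *)
Definition is_edge_set (p : nat) (E : {set 'I_p * 'I_p}) : bool :=
  [forall e in E, (e.1 < e.2)%N].

Definition adj (p : nat) (E : {set 'I_p * 'I_p}) (j k : 'I_p) : bool :=
  ((j, k) \in E) || ((k, j) \in E).

(* Decomposable = chordal: every cycle of length >= 4 (on distinct vertices)
   has a chord, i.e. an edge between two non-consecutive cycle vertices. *)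
Definition decomposable (p : nat) (E : {set 'I_p * 'I_p}) : Prop :=
  forall (m : nat) (v : 'I_(m.+4) -> 'I_p),
    injective v ->
    (forall i : 'I_(m.+4), adj E (v i) (v (ordS i))) ->
    exists i j : 'I_(m.+4),
      [/\ i != j, j != ordS i, i != ordS j & adj E (v i) (v j)].

Definition posdef (R : realType) (p : nat) (T : 'M[R]_p) : Prop :=
  T^T = T /\ forall x : 'cV[R]_p, x != 0 -> 0 < (x^T *m T *m x) ord0 ord0.

Definition exact_pattern (R : realType) (p : nat) (T : 'M[R]_p)
  (E : {set 'I_p * 'I_p}) : Prop :=
  (forall j, T j j != 0) /\
  (forall j k, j != k -> (T j k != 0) = adj E j k).

(* The Gaussian graphical model E (in terms of the concentration matrix). *)
Definition in_model (R : realType) (p : nat) (E : {set 'I_p * 'I_p})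
  (T : 'M[R]_p) : Prop :=
  posdef T /\ (forall j k, j != k -> ~~ adj E j k -> T j k = 0).

Definition sample_cov (R : realType) (p n : nat) (X : 'I_n -> 'cV[R]_p)
  : 'M[R]_p := n%:R^-1 *: \sum_(i < n) (X i *m (X i)^T).

Definition loglik (R : realType) (p : nat) (n : nat) (S T : 'M[R]_p) : R :=
  n%:R / 2 * (ln (\det T) - \tr (S *m T)).

(* l_n(hat Theta(E)), the maximized log-likelihood over the model E,
   taken as a supremum in the extended reals (+oo if unbounded). *)
Definition max_loglik (R : realType) (p : nat) (n : nat) (S : 'M[R]_p)
  (E : {set 'I_p * 'I_p}) : \bar R :=
  ereal_sup [set (loglik n S T)%:E | T in [set T | in_model E T]].

Definition sigma2_max (R : realType) (p : nat) (T : 'M[R]_p) : R :=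
  \big[Num.max/0]_(j < p) (invmx T) j j.

Definition lambda_max (R : realType) (p : nat) (T : 'M[R]_p) : R :=
  sup [set a : R | eigenvalue T a].

(* theta_0 = min over edges of |T_jk| (the default value of the fold is the
   max, so this is the true minimum when E is nonempty; 0 if E is empty). *)
Definition theta_min (R : realType) (p : nat) (T : 'M[R]_p)
  (E : {set 'I_p * 'I_p}) : R :=
  \big[Num.min/ \big[Num.max/0]_(e in E) `|T e.1 e.2| ]_(e in E) `|T e.1 e.2|.

Definition iid_std_normal (R : realType) (d : measure_display)
  (Omega : measurableType d) (P : probability Omega R) (I : eqType)
  (Z : I -> Omega -> R) : Prop :=
  (forall k, measurable_fun setT (Z k)) /\
  (forall k (B : set R), measurable B ->
      P (Z k @^-1` B) = normal_prob 0 1 B) /\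
  (forall (K : seq I) (B : I -> set R), uniq K ->
      (forall k, measurable (B k)) ->
      P (\bigcap_(k in [set k | k \in K]) (Z k @^-1` B k)) =
      (\big[*%E/1%E]_(k <- K) P (Z k @^-1` B k))%E).

(* The i-th sample X_i = L z_i, z_i standard normal in R^p; if L L^T =
   Theta0^{-1} then X_1..X_n are iid N(0, Theta0^{-1}). *)
Definition sample (R : realType) (Omega : Type) (p : nat) (L : 'M[R]_p)
  (Z : nat * nat -> Omega -> R) (w : Omega) (i : nat) : 'cV[R]_p :=
  L *m \col_(j < p) Z (i, nat_of_ord j) w.

(* Main.v *)
(* Let D = Theta - Theta_0 for Theta in a model missing an edge of E_0, let
   L L^T = Theta_0^-1 = Sigma_0, and write the log-likelihood difference as
     (n/2) [tr (Sigma_0 D) - ln det Theta + ln det Theta_0 - tr ((Sigma_0 - S) D)].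
   The first three terms are Stein's loss of M = L^T Theta L, which a Cholesky
   factorization bounds below by x^2 / (4 (1 + x)) with x = |D|_F / lambda_max.
   Since |D|_F >= theta_0 and D has at most p + 4q nonzero entries, this
   dominates the last term as soon as every entry of Sigma_0 - S is
   O(sigma_max^2 sqrt (ln p / n)); the resulting gap is of order
   n theta_0^2 / lambda_max^2, hence beats q ln p by (v).
   The entries of Sigma_0 - S are controlled by polarization, a union bound and
   Chernoff bounds for sums of squares of linear forms G in the standard
   normals.  Only the moment generating function of linear forms is used:
   exp (s G^2) is a Gaussian mixture of exponentials of G, and
   exp (- s G^2) <= 1 / y <= 3 - 3 y + y^2 with y = cosh (sqrt (2 s) G). *)
Require Import Defs.
From HB Require Import structures.
From mathcomp Require Import all_boot all_order all_algebra.
From mathcomp Require Import all_classical all_reals all_analysis.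
From mathcomp Require Import normal_distribution.
From mathcomp Require Import measurable_realfun ring lra.
Import Order.TTheory GRing.Theory Num.Theory.
Import numFieldTopology.Exports numFieldNormedType.Exports.
Set Implicit Arguments.
Unset Strict Implicit.
Unset Printing Implicit Defensive.
Local Open Scope classical_set_scope.
Local Open Scope ring_scope.

(** * Frobenius norm, Cholesky factorization and Stein's loss *)

(** The deviation event concerns the entries of S alone, so one event of probability at least 1 -
    4/p serves all models: there is no union bound over edge sets. No maximizer is analysed either,
    since a gap valid for each Theta of a model survives the supremum. The shape x^2 / (1 + x) makes
    this possible: Stein's loss is quadratic near Theta_0 and linear far away, the score term is
    linear in x, and comparing their slopes for x >= theta_0 / lambda_max settles every Theta
    without localization. The bound on sigma_max^2 lambda_max enters when the score is rewritten in
    terms of x. Independence is a product formula for events, so integrals of functions have to be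
    recovered from level sets. As a mixture, exp (- s G^2) would need imaginary exponents, hence the
    detour by cosh. There 3 - 3 y + y^2 is the second-order Taylor polynomial of 1 / y at 1, which
    keeps the first-order term in s that a Chernoff bound requires. *)

Lemma cauchy_schwarz_sum (R : realType) (I : finType) (Q : pred I) (a b : I -> R) :
  (\sum_(i | Q i) a i * b i) ^+ 2 <= (\sum_(i | Q i) a i ^+ 2) * (\sum_(i | Q i) b i ^+ 2).
Proof.
set A := \sum_(i | Q i) a i ^+ 2; set B := \sum_(i | Q i) b i ^+ 2.
set c := \sum_(i | Q i) a i * b i.
have A0 : 0 <= A by apply: sumr_ge0 => i _; exact: sqr_ge0.
have B0 : 0 <= B by apply: sumr_ge0 => i _; exact: sqr_ge0.
(* This polynomial is the sum of the [(t * a i + b i) ^+ 2]. It is evaluated at its minimizer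
   [- c / A], or, when [A = 0] and [c != 0], at a point where the remaining affine function would be
   -1. *)
have H t : 0 <= t ^+ 2 * A + 2 * t * c + B.
  rewrite /A /B /c !mulr_sumr -!big_split /=; apply: sumr_ge0 => i _.
  rewrite (_ : _ + _ = (t * a i + b i) ^+ 2); first exact: sqr_ge0.
  by ring.
have [A00|A_neq0] := eqVneq A 0.
  have [->|c0] := eqVneq c 0; first by rewrite expr0n A00 mul0r.
  have := H (- (B + 1) / (2 * c)); rewrite A00 mulr0 add0r.
  rewrite (_ : 2 * _ * c + B = -1); [by rewrite ler0N1|by field].
have A_gt0 : 0 < A by rewrite lt_neqAle eq_sym A_neq0.
have := H (- c / A).
rewrite (_ : (- c / A) ^+ 2 * A + 2 * (- c / A) * c + B = (A * B - c ^+ 2) / A); last by field.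
by rewrite pmulr_lge0 ?invr_gt0// subr_ge0.
Qed.

Lemma trmxZ (R : realType) (m n : nat) (a : R) (A : 'M[R]_(m, n)) :
  (a *: A)^T = a *: A^T.
Proof. exact: linearZ. Qed.

Lemma trmxD (R : realType) (m n : nat) (A B : 'M[R]_(m, n)) : (A + B)^T = A^T + B^T.
Proof. exact: linearD. Qed.

Lemma trmxB (R : realType) (m n : nat) (A B : 'M[R]_(m, n)) : (A - B)^T = A^T - B^T.
Proof. exact: linearB. Qed.

Definition fro2 (R : realType) (m n : nat) (A : 'M[R]_(m, n)) : R :=
  \sum_i \sum_j A i j ^+ 2.

Definition fro (R : realType) (m n : nat) (A : 'M[R]_(m, n)) : R :=
  Num.sqrt (fro2 A).

Lemma fro2_ge0 (R : realType) (m n : nat) (A : 'M[R]_(m, n)) : 0 <= fro2 A.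
Proof. by apply: sumr_ge0 => i _; apply: sumr_ge0 => j _; exact: sqr_ge0. Qed.

Lemma fro_ge0 (R : realType) (m n : nat) (A : 'M[R]_(m, n)) : 0 <= fro A.
Proof. exact: sqrtr_ge0. Qed.

Lemma sqr_fro (R : realType) (m n : nat) (A : 'M[R]_(m, n)) : fro A ^+ 2 = fro2 A.
Proof. by rewrite sqr_sqrtr ?fro2_ge0. Qed.

Lemma fro2_tr (R : realType) (m n : nat) (A : 'M[R]_(m, n)) : fro2 A^T = fro2 A.
Proof.
rewrite /fro2 exchange_big; apply: eq_bigr => i _; apply: eq_bigr => j _.
by rewrite mxE.
Qed.

Lemma fro2_eq0 (R : realType) (m n : nat) (A : 'M[R]_(m, n)) : fro2 A = 0 -> A = 0.
Proof.
move=> /eqP; rewrite psumr_eq0 => [|i _]; last by apply: sumr_ge0 => j _; exact: sqr_ge0.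
move=> /allP H; apply/matrixP => i j; rewrite mxE.
have := H i (mem_index_enum _); rewrite psumr_eq0 => [|k _]; last exact: sqr_ge0.
by move=> /allP /(_ j (mem_index_enum _)); rewrite sqrf_eq0 => /eqP.
Qed.

Lemma fro2_gt0 (R : realType) (m n : nat) (A : 'M[R]_(m, n)) : A != 0 -> 0 < fro2 A.
Proof.
move=> A0; rewrite lt_neqAle fro2_ge0 andbT eq_sym.
by apply: contra_neq A0 => /fro2_eq0.
Qed.

Lemma mxtrace_mul_tr (R : realType) (m n : nat) (A B : 'M[R]_(m, n)) :
  \tr (A *m B^T) = \sum_i \sum_j A i j * B i j.
Proof.
by apply: eq_bigr => i _; rewrite mxE; apply: eq_bigr => j _; rewrite mxE.
Qed.

Lemma fro2E (R : realType) (m n : nat) (A : 'M[R]_(m, n)) : fro2 A = \tr (A *m A^T).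
Proof.
by rewrite mxtrace_mul_tr; apply: eq_bigr => i _; apply: eq_bigr => j _; rewrite expr2.
Qed.

Lemma fro2_col (R : realType) (m : nat) (x : 'cV[R]_m) :
  fro2 x = (x^T *m x) ord0 ord0.
Proof.
by rewrite -fro2_tr fro2E trmxK /mxtrace big_ord_recl big_ord0 addr0.
Qed.

Lemma inner_le (R : realType) (m n : nat) (A B : 'M[R]_(m, n)) :
  (\sum_i \sum_j A i j * B i j) ^+ 2 <= fro2 A * fro2 B.
Proof.
by rewrite /fro2 !pair_big /=; exact: cauchy_schwarz_sum.
Qed.

Lemma froD (R : realType) (m n : nat) (A B : 'M[R]_(m, n)) :
  fro (A + B) <= fro A + fro B.
Proof.
have [A0 B0] := (fro_ge0 A, fro_ge0 B).
have AB : \sum_i \sum_j A i j * B i j <= fro A * fro B.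
  apply: le_trans (ler_norm _) _.
  rewrite -(@ler_pXn2r _ 2) ?nnegrE ?mulr_ge0// real_normK ?num_real//.
  by rewrite exprMn !sqr_fro; exact: inner_le.
rewrite -(@ler_pXn2r _ 2) ?nnegrE ?fro_ge0 ?addr_ge0//.
rewrite sqrrD !sqr_fro.
have -> : fro2 (A + B) = fro2 A + (\sum_i \sum_j A i j * B i j) *+ 2 + fro2 B.
  rewrite /fro2 -sumrMnl -!big_split /=; apply: eq_bigr => i _.
  rewrite -sumrMnl -!big_split /=; apply: eq_bigr => j _.
  by rewrite mxE sqrrD.
by rewrite lerD2r lerD2l lerMn2r.
Qed.

Lemma fro2M (R : realType) (m n k : nat) (A : 'M[R]_(m, n)) (B : 'M[R]_(n, k)) :
  fro2 (A *m B) <= fro2 A * fro2 B.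
Proof.
rewrite -(fro2_tr B) {1}/fro2 {1}/fro2 mulr_suml; apply: ler_sum => i _.
rewrite /fro2 mulr_sumr; apply: ler_sum => j _.
rewrite mxE.
under [X in _ <= _ * X]eq_bigr do rewrite mxE.
exact: cauchy_schwarz_sum.
Qed.

Lemma froM (R : realType) (m n k : nat) (A : 'M[R]_(m, n)) (B : 'M[R]_(n, k)) :
  fro (A *m B) <= fro A * fro B.
Proof. by rewrite -sqrtrM ?fro2_ge0// ler_wsqrtr// fro2M. Qed.

Lemma fro_tr (R : realType) (m n : nat) (A : 'M[R]_(m, n)) : fro A^T = fro A.
Proof. by rewrite /fro fro2_tr. Qed.

Lemma fro2_mul_col (R : realType) (m n k : nat) (J : 'M[R]_(m, n)) (A : 'M[R]_(n, k)) :
  fro2 (J *m A) = \sum_j fro2 (J *m col j A).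
Proof.
rewrite {1}/fro2 exchange_big; apply: eq_bigr => j _.
rewrite /fro2; apply: eq_bigr => i _; rewrite big_ord1 !mxE.
by congr (_ ^+ 2); apply: eq_bigr => l _; rewrite mxE.
Qed.

Lemma fro2_sum_col (R : realType) (m n : nat) (A : 'M[R]_(m, n)) :
  fro2 A = \sum_j fro2 (col j A).
Proof.
rewrite {1}/fro2 exchange_big; apply: eq_bigr => j _.
rewrite /fro2; apply: eq_bigr => i _; rewrite big_ord1.
by rewrite mxE.
Qed.

(** The squared Frobenius norm splits over columns. Unlike [fro2M], this costs a squared operator
    norm, which is how [lambda_max] enters in place of a larger Frobenius norm. *)
Lemma opnorm_mul (R : realType) (m n k : nat) (J : 'M[R]_(m, n)) (l : R) :
  (forall x : 'cV[R]_n, fro2 (J *m x) <= l * fro2 x) ->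
  forall A : 'M[R]_(n, k), fro2 (J *m A) <= l * fro2 A.
Proof.
move=> Jl A; rewrite fro2_mul_col fro2_sum_col mulr_sumr.
by apply: ler_sum => j _.
Qed.

(** With y = J^T x, the inner product of x and J y is |y|^2; Cauchy-Schwarz and the bound on J y
    then allow cancelling one factor |y|^2. *)
Lemma opnorm_tr (R : realType) (m n : nat) (J : 'M[R]_(m, n)) (l : R) : 0 <= l ->
  (forall x : 'cV[R]_n, fro2 (J *m x) <= l * fro2 x) ->
  forall x : 'cV[R]_m, fro2 (J^T *m x) <= l * fro2 x.
Proof.
move=> l0 Jl x; set y := J^T *m x.
have [->|y0] := eqVneq (fro2 y) 0; first by rewrite mulr_ge0// fro2_ge0.
have y_gt0 : 0 < fro2 y by rewrite lt_neqAle eq_sym y0 fro2_ge0.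
have /le_trans /(_ (ler_wpM2l (fro2_ge0 x) (Jl y))) := inner_le x (J *m y).
rewrite -mxtrace_mul_tr trmx_mul mulmxA mxtrace_mulC.
rewrite -[J^T *m _]/(J^T *m (x *m y^T)) mulmxA -/y -fro2E expr2 mulrA ler_pM2r//.
by rewrite mulrC.
Qed.

Definition qform (R : realType) (p : nat) (A : 'M[R]_p) (x : 'cV[R]_p) : R :=
  (x^T *m A *m x) ord0 ord0.

Lemma qformB (R : realType) (p : nat) (A B : 'M[R]_p) x :
  qform (A - B) x = qform A x - qform B x.
Proof. by rewrite /qform mulmxBr mulmxBl !mxE. Qed.

Lemma qform_scalar (R : realType) (p : nat) (a : R) (x : 'cV[R]_p) :
  qform a%:M x = a * fro2 x.
Proof. by rewrite /qform mul_mx_scalar -scalemxAl mxE fro2_col. Qed.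

Lemma qformZ (R : realType) (p : nat) (A : 'M[R]_p) a x :
  qform A (a *: x) = a ^+ 2 * qform A x.
Proof.
by rewrite /qform trmxZ -!scalemxAl -scalemxAr !mxE mulrA expr2.
Qed.

Lemma qform_gram (R : realType) (p m : nat) (T : 'M[R]_(p, m)) x :
  qform (T *m T^T) x = fro2 (T^T *m x).
Proof. by rewrite fro2_col trmx_mul trmxK /qform !mulmxA. Qed.

Lemma qformD (R : realType) (p : nat) (A : 'M[R]_p) x y : A^T = A ->
  qform A (x + y) = qform A x + 2 * (y^T *m A *m x) ord0 ord0 + qform A y.
Proof.
move=> AT.
have D (a b : 'M[R]_1) : (a + b) ord0 ord0 = a ord0 ord0 + b ord0 ord0 by rewrite mxE.
rewrite /qform trmxD !mulmxDl !mulmxDr !D.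
have -> : (x^T *m A *m y) ord0 ord0 = (y^T *m A *m x) ord0 ord0.
  by rewrite -[in LHS](trmxK y) -[in LHS]AT -!trmx_mul [LHS]mxE mulmxA.
ring.
Qed.

Lemma posdef_schur (R : realType) (p : nat) (a : R) (v : 'cV[R]_p) (D : 'M[R]_p) :
  posdef (block_mx a%:M (v^T) v D : 'M[R]_(1 + p)) ->
  0 < a /\ posdef (D - a^-1 *: (v *m v^T)).
Proof.
move=> [MT Mpos].
have a0 : 0 < a.
  have := Mpos (col_mx 1%:M 0).
  rewrite tr_col_mx mul_row_block mul_row_col !trmx0 !mul0mx mulmx0 trmx1 !mul1mx !addr0.
  rewrite mulmx1 mxE eqxx; apply.
  by apply/eqP => /(congr1 usubmx); rewrite col_mxKu linear0 => /matrixP /(_ ord0 ord0) /eqP;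
    rewrite !mxE eqxx oner_eq0.
split=> //; split.
  have DT : D^T = D.
    by have := congr1 drsubmx MT; rewrite tr_block_mx !block_mxKdr.
  by rewrite trmxB trmxZ trmx_mul trmxK DT.
move=> y y0.
set c := v^T *m y.
(* For fixed [y] this first coordinate minimizes the block form, and the minimum is the form of the
   Schur complement. *)
have := Mpos (col_mx (- a^-1 *: c) y).
rewrite tr_col_mx mul_row_block mul_row_col.
have cT : c^T = y^T *m v by rewrite trmx_mul trmxK.
rewrite trmxZ cT mul_mx_scalar scalerA mulrN divff ?gt_eqF// scaleN1r addNr mul0mx add0r.
rewrite mulmxBr -scalemxAr !mulmxA -scalemxAl !scaleNr addrC; apply.
by apply/eqP => /(congr1 dsubmx); rewrite col_mxKd linear0; apply/eqP.
Qed.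

Lemma cholesky (R : realType) (p : nat) (M : 'M[R]_p) : posdef M ->
  exists T : 'M[R]_p, [/\ is_trig_mx T, (forall i, 0 < T i i) & M = T *m T^T].
Proof.
elim: p M => [|p IH] M Mpos.
  exists 0; split; [exact: mx0_is_trig|by case|].
  by apply/matrixP => -[].
pose M' : 'M[R]_(1 + p) := M.
pose a := ulsubmx M' ord0 ord0; pose v := dlsubmx M'; pose D := drsubmx M'.
have ME : M' = block_mx a%:M (v^T) v D.
  have MT : M'^T = M' := Mpos.1.
  rewrite -[LHS]submxK; congr block_mx.
    by apply/matrixP => i j; rewrite !ord1 [RHS]mxE eqxx.
  by rewrite /v trmx_dlsub MT.
have [a0 /IH [T [Ttrig Tpos DE]]] : 0 < a /\ posdef (D - a^-1 *: (v *m v^T)).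
  by apply: posdef_schur; rewrite -ME.
pose T1 : 'M[R]_(1 + p) := block_mx (Num.sqrt a)%:M 0 ((Num.sqrt a)^-1 *: v) T.
have sa : Num.sqrt a != 0 by rewrite gt_eqF// sqrtr_gt0.
have sa2 : Num.sqrt a * Num.sqrt a = a by rewrite -expr2 sqr_sqrtr// ltW.
have T1trig : is_trig_mx T1 by rewrite is_trig_block_mx// eqxx scalar_mx_is_trig.
have T1pos i : 0 < T1 i i.
  case: (split_ordP i) => j ->.
    by rewrite block_mxEul !ord1 mxE eqxx sqrtr_gt0.
  by rewrite block_mxEdr.
have T1E : M' = T1 *m T1^T.
  rewrite ME tr_block_mx mulmx_block !trmx0 !mul0mx !mulmx0 !addr0.
  rewrite trmxZ tr_scalar_mx -scalar_mxM sa2 mul_scalar_mx scalerA divff// scale1r.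
  rewrite mul_mx_scalar scalerA divff// scale1r -scalemxAl -scalemxAr scalerA -invfM sa2 -DE.
  by rewrite addrC subrK.
by exists T1.
Qed.

Lemma ln_prod (R : realType) (I : finType) (f : I -> R) : (forall i, 0 < f i) ->
  ln (\prod_i f i) = \sum_i ln (f i).
Proof.
move=> f0; suff [_ ->] : 0 < \prod_i f i /\ ln (\prod_i f i) = \sum_i ln (f i) by [].
apply: (big_rec2 (fun x y => 0 < x /\ ln x = y)) => [|i y x _ [x0 <-]].
  by rewrite ln1.
by rewrite mulr_gt0// lnM// ?posrE.
Qed.

(* With M = T T^T, T triangular, the right-hand side is the sum of the
   T_ii^2 - 1 - 2 ln T_ii >= (T_ii - 1)^2 and of the off-diagonal T_ij^2. *)
Lemma stein_loss (R : realType) (p : nat) (M : 'M[R]_p) : posdef M ->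
  exists2 T : 'M[R]_p, M = T *m T^T &
    fro2 (T - 1%:M) <= \tr M - p%:R - ln (\det M).
Proof.
move=> /cholesky [T [Ttrig Tpos ->]]; exists T => //.
have -> : fro2 (T - 1%:M) = fro2 T - 2 * \tr T + p%:R.
  rewrite !fro2E trmxB mulmxBr !mulmxBl trmx1 !mulmx1 mul1mx !linearB /= mxtrace1 mxtrace_tr.
  ring.
rewrite -fro2E det_mulmx det_tr det_trig// lnM ?posrE ?prodr_gt0// ln_prod//.
have : \sum_i ln (T i i) <= \tr T - p%:R.
  rewrite /mxtrace -[p in p%:R]card_ord -sumr_const -sumrB; apply: ler_sum => i _.
  have := @le_ln1Dx _ (T i i - 1).
  by rewrite [1 + _]addrC subrK; apply; rewrite ltrBrDl subrr; exact: Tpos.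
by lra.
Qed.

(* m <= e^2 + 2 e for e the norm of T - 1. *)
Lemma fro2_sub1_ge (R : realType) (p : nat) (T : 'M[R]_p) (m := fro (T *m T^T - 1%:M)) :
  m ^+ 2 / (4 * (1 + m)) <= fro2 (T - 1%:M).
Proof.
rewrite -sqr_fro; set e := fro _.
have m0 : 0 <= m := fro_ge0 _.
have e0 : 0 <= e := fro_ge0 _.
have me : m <= e ^+ 2 + 2 * e.
  rewrite /m (_ : _ - _ = (T - 1%:M) *m (T - 1%:M)^T + ((T - 1%:M) + (T - 1%:M)^T)).
    apply: le_trans (froD _ _) _; apply: lerD.
      by apply: le_trans (froM _ _) _; rewrite fro_tr expr2.
    by apply: le_trans (froD _ _) _; rewrite fro_tr mulr_natl mulr2n.
  rewrite trmxB trmx1 mulmxBr !mulmxBl !mulmx1 mul1mx.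
  by rewrite addrA subrK addrA subrK.
rewrite ler_pdivrMr; last by lra.
(* If [m <= 2 * e], already m^2 / 4 <= e^2. Otherwise [me] is used twice: once for a factor of m^2,
   once to bound [m * (e + 2)]. *)
have [em|em] := leP m (2 * e); first by nra.
have : m ^+ 2 <= m * (e * (e + 2)) by rewrite expr2 ler_wpM2l//; lra.
have : m * (e + 2) <= 4 * (1 + m) * e by nra.
by move=> /(ler_wpM2l e0); lra.
Qed.

(** A zero of a nonnegative form is a minimum, so the gradient, proportional to B x, vanishes there;
    the test is a small move along B x. *)
Lemma psd_ker (R : realType) (p : nat) (B : 'M[R]_p) x : B^T = B ->
  (forall y, 0 <= qform B y) -> qform B x = 0 -> B *m x = 0.
Proof.
move=> BT B0 Bx0; apply: fro2_eq0; set c := fro2 _.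
have cE : (((B *m x)^T) *m B *m x) ord0 ord0 = c by rewrite /c fro2_col mulmxA.
set d := qform B (B *m x); have d0 : 0 <= d := B0 _.
have c0 : 0 <= c := fro2_ge0 _.
(* The [+ 1] keeps the step defined when [d = 0]; the form at the moved point is still negative
   unless [c = 0]. *)
pose t := - c / (d + 1).
have := B0 (x + t *: (B *m x)).
rewrite qformD// Bx0 qformZ -/d trmxZ -!scalemxAl mxE cE add0r.
have d1 : 0 < d + 1 by lra.
have -> : 2 * (t * c) + t ^+ 2 * d = - (c ^+ 2 * (d + 2)) / (d + 1) ^+ 2.
  by rewrite /t; field; rewrite gt_eqF.
rewrite mulNr oppr_ge0 pmulr_lle0 ?invr_gt0 ?exprn_gt0// pmulr_lle0; last by lra.
by move=> H; apply/eqP; rewrite -(sqrf_eq0 c) eq_le H sqr_ge0.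
Qed.

Lemma posdef_of_unit (R : realType) (p : nat) (B : 'M[R]_p) : B^T = B ->
  (forall y, 0 <= qform B y) -> B \in unitmx -> posdef B.
Proof.
move=> BT B0 Bu; split=> // x x0; rewrite lt_neqAle B0 andbT eq_sym.
apply: contra_neq x0 => /(psd_ker BT B0) /(congr1 (mulmx (invmx B))).
by rewrite mulmxA mulVmx// mul1mx mulmx0.
Qed.

Lemma posdef_unit (R : realType) (p : nat) (B : 'M[R]_p) : posdef B -> B \in unitmx.
Proof.
move=> /cholesky [T [Ttrig Tpos ->]].
have T0 : \prod_i T i i != 0 by apply/prodf_neq0 => i _; rewrite gt_eqF.
by rewrite unitmxE unitfE det_mulmx det_tr det_trig// mulf_neq0.
Qed.

Lemma posdef_det_gt0 (R : realType) (p : nat) (B : 'M[R]_p) : posdef B -> 0 < \det B.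
Proof.
move=> /cholesky [T [Ttrig Tpos ->]].
by rewrite det_mulmx det_tr det_trig// mulr_gt0// prodr_gt0.
Qed.

Lemma posdef_coercive (R : realType) (p : nat) (B : 'M[R]_p) : posdef B ->
  exists2 K, 0 < K & forall x, fro2 x <= K * qform B x.
Proof.
move=> Bpos; have [T [_ _ BE]] := cholesky Bpos.
have Tu : T^T \in unitmx.
  by have := posdef_unit Bpos; rewrite BE unitmx_mul => /andP[].
(* The [+ 1] keeps the constant positive even when [p = 0]. *)
exists (fro2 (invmx T^T) + 1) => [|x]; first by rewrite ltr_wpDl ?fro2_ge0.
rewrite BE qform_gram -{1}[x](mulKmx Tu).
apply: le_trans (fro2M _ _) _.
by rewrite ler_wpM2r ?fro2_ge0// lerDl.
Qed.

Lemma qform_le_fro (R : realType) (p : nat) (A : 'M[R]_p) x :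
  qform A x <= fro A * fro2 x.
Proof.
apply: le_trans (ler_norm _) _.
rewrite -(@ler_pXn2r _ 2) ?nnegrE ?mulr_ge0 ?fro_ge0 ?fro2_ge0// real_normK ?num_real//.
rewrite exprMn sqr_fro /qform -mulmxA.
have -> : (x^T *m (A *m x)) ord0 ord0 = \sum_i \sum_j x i j * (A *m x) i j.
  by rewrite mxE; apply: eq_bigr => i _; rewrite big_ord1 mxE.
apply: le_trans (inner_le _ _) _.
by rewrite mulrC expr2 mulrA ler_wpM2r ?fro2_ge0// fro2M.
Qed.

Lemma eigenvalue_sym (R : realType) (p : nat) (A : 'M[R]_p) a : A^T = A ->
  eigenvalue A a -> exists2 x : 'cV[R]_p, x != 0 & qform A x = a * fro2 x.
Proof.
move=> AT /eigenvalueP [v vA v0]; exists v^T.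
  by apply: contra_neq v0 => /(congr1 trmx); rewrite trmxK trmx0.
by rewrite /qform trmxK vA -scalemxAl mxE fro2_col trmxK.
Qed.

(** [lambda_max] is just the supremum of the eigenvalues. The point is that the supremum of the
    Rayleigh quotient is itself an eigenvalue, which takes the place of a diagonalization. *)
Lemma qform_le_lambda_max (R : realType) (p : nat) (A : 'M[R]_p) x : A^T = A ->
  qform A x <= lambda_max A * fro2 x.
Proof.
move=> AT; have [->|x0] := eqVneq x 0.
  by rewrite /qform mulmx0 mxE /fro2 big1 ?mulr0// => i _; rewrite big1// => j _;
    rewrite mxE expr0n.
pose S := [set r | exists2 y : 'cV[R]_p, y != 0 & r = qform A y / fro2 y].
have Sub r : S r -> r <= fro A.
  by move=> [y y0 ->]; rewrite ler_pdivrMr ?fro2_gt0// qform_le_fro.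
have S0 : S !=set0 by exists (qform A x / fro2 x); exists x.
have Ssup : has_sup S by split=> //; exists (fro A) => r; exact: Sub.
set l := sup S.
have lP y : qform A y <= l * fro2 y.
  have [->|y0] := eqVneq y 0.
    by rewrite /qform mulmx0 mxE /fro2 big1 ?mulr0// => i _; rewrite big1// => j _;
      rewrite mxE expr0n.
  by rewrite -ler_pdivrMr ?fro2_gt0//; apply: ub_le_sup; [exact: Ssup.2|exists y].
pose B := l%:M - A.
have BT : B^T = B by rewrite trmxB tr_scalar_mx AT.
have Bq y : qform B y = l * fro2 y - qform A y by rewrite qformB qform_scalar.
have B0 y : 0 <= qform B y by rewrite Bq subr_ge0.
have eigub a : eigenvalue A a -> a <= l.
  move=> /(eigenvalue_sym AT) [y y0 ya].
  by have := lP y; rewrite ya ler_pM2r// fro2_gt0.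
(* [l - A] is singular: otherwise it would be coercive and [l] not the supremum. *)
suff leig : eigenvalue A l.
  apply: le_trans (lP x) _; rewrite ler_wpM2r ?fro2_ge0//.
  by apply: ub_le_sup => //; exists l => a; exact: eigub.
have [Bu|Bnu] := boolP (B \in unitmx).
  have [K K0 KP] := posdef_coercive (posdef_of_unit BT B0 Bu).
  have : l <= l - K^-1.
    apply: sup_le_ub => // r [y y0 ->].
    rewrite ler_pdivrMr ?fro2_gt0//.
    have -> : (l - K^-1) * fro2 y = l * fro2 y - K^-1 * fro2 y by ring.
    have := KP y; rewrite Bq -ler_pdivrMl//; lra.
  have : 0 < K^-1 by rewrite invr_gt0.
  lra.
rewrite unitmxE unitfE negbK in Bnu.
have /det0P [v v0 vB] := Bnu.
apply/eigenvalueP; exists v => //.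
by move: vB; rewrite mulmxBr mul_mx_scalar => /eqP; rewrite subr_eq0 => /eqP.
Qed.

(** With J = L^-1 and M = L^T T L, one has T0 = J^T J and T - T0 = J^T (M - 1) J. The squared
    operator norm of J is at most [lambda_max T0], so |T - T0|_F / lambda_max <= |M - 1|_F, and the
    lower bound on Stein's loss is increasing in that norm. *)
Lemma loglik_loss (R : realType) (p : nat) (T0 T L : 'M[R]_p)
  (x := fro (T - T0) / lambda_max T0) :
  posdef T0 -> posdef T -> L *m L^T = invmx T0 -> 0 < lambda_max T0 ->
  x ^+ 2 / (4 * (1 + x)) <=
    \tr (invmx T0 *m (T - T0)) - (ln (\det T) - ln (\det T0)).
Proof.
move=> T0pos Tpos LL l0.
have T0u := posdef_unit T0pos.
have Lu : L \in unitmx.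
  by have := unitmx_inv T0; rewrite T0u -LL unitmx_mul => /andP[].
pose J := invmx L.
have JJ : J^T *m J = T0.
  rewrite -[RHS]invmxK -LL; apply: (can_inj (mulmxK (_ : L *m L^T \in unitmx))).
    by rewrite unitmx_mul unitmx_tr Lu.
  rewrite mulVmx ?unitmx_mul ?unitmx_tr ?Lu//.
  by rewrite -mulmxA (mulmxA J) mulVmx// mul1mx -trmx_mul mulmxV// trmx1.
pose M := L^T *m T *m L.
have Mpos : posdef M.
  split; first by rewrite !trmx_mul trmxK Tpos.1 mulmxA.
  move=> y y0; have := Tpos.2 (L *m y); rewrite trmx_mul !mulmxA; apply.
  by apply: contra_neq y0 => /(congr1 (mulmx J)); rewrite mulmx0 mulmxA mulVmx// mul1mx.
have [U MU] := stein_loss Mpos.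
have trM : \tr M - p%:R = \tr (invmx T0 *m (T - T0)).
  by rewrite /M -mulmxA mxtrace_mulC -mulmxA LL mxtrace_mulC mulmxBr mulVmx// linearB /= mxtrace1.
have detM : ln (\det M) = ln (\det T) - ln (\det T0).
  rewrite -ln_div ?posrE ?posdef_det_gt0// /M !det_mulmx mulrAC -[\det L^T * _]mulrC -det_mulmx LL.
  by rewrite det_inv mulrC.
rewrite trM detM; apply: le_trans.
apply: le_trans (fro2_sub1_ge _).
rewrite -MU; set m := fro _.
have m0 : 0 <= m := fro_ge0 _.
have x0 : 0 <= x by rewrite divr_ge0 ?fro_ge0// ltW.
have Jl (y : 'cV[R]_p) : fro2 (J *m y) <= lambda_max T0 * fro2 y.
  rewrite -{1}(trmxK J) -qform_gram trmxK JJ.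
  by apply: qform_le_lambda_max; exact: T0pos.1.
have xm : x <= m.
  rewrite ler_pdivrMr// -(@ler_pXn2r _ 2) ?nnegrE ?mulr_ge0 ?fro_ge0 ?(ltW l0)//.
  rewrite exprMn !sqr_fro.
  have -> : T - T0 = J^T *m ((M - 1%:M) *m J).
    rewrite mulmxBl mulmxBr mul1mx JJ; congr (_ - _).
    rewrite /M -!mulmxA (mulmxV Lu) mulmx1 mulmxA -trmx_mul mulmxV// trmx1 mul1mx.
    by [].
  apply: le_trans (opnorm_mul (opnorm_tr (ltW l0) Jl) _) _.
  rewrite mulrC expr2 mulrA ler_wpM2r ?(ltW l0)//.
  by rewrite -fro2_tr trmx_mul -[fro2 (M - _)]fro2_tr mulrC; apply: opnorm_mul;
    exact: opnorm_tr (ltW l0) Jl.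
rewrite ler_pdivrMr ?mulr_gt0//; last by lra.
rewrite mulrAC ler_pdivlMr ?mulr_gt0//; last by lra.
(* Monotonicity of t^2 / (1 + t): after cross-multiplication the difference is (m - x) (m x + m +
   x). *)
have mx : 0 <= m - x by rewrite subr_ge0.
have := mulr_ge0 (mulr_ge0 m0 x0) mx; have := mulr_ge0 (addr_ge0 m0 x0) mx.
lra.
Qed.

(** * Matrix entries, supports and the score term *)

Lemma delta_qform (R : realType) (p : nat) (T : 'M[R]_p) a b :
  ((delta_mx a ord0)^T *m T *m delta_mx b ord0 : 'M[R]_1) ord0 ord0 = T a b.
Proof. by rewrite trmx_delta -rowE -colE !mxE. Qed.

Lemma qform_deltaD (R : realType) (p : nat) (T : 'M[R]_p) j k : T^T = T ->
  qform T (delta_mx j ord0 + delta_mx k ord0) = T j j + 2 * T j k + T k k.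
Proof.
move=> TT; rewrite qformD// /qform !delta_qform (_ : T k j = T j k)//.
by rewrite -[in LHS]TT mxE.
Qed.

Lemma qform_deltaB (R : realType) (p : nat) (T : 'M[R]_p) j k : T^T = T ->
  qform T (delta_mx j ord0 - delta_mx k ord0) = T j j - 2 * T j k + T k k.
Proof.
move=> TT; rewrite -scaleN1r qformD// qformZ trmxZ -!scalemxAl.
have -> (M : 'M[R]_1) : (-1 *: M) ord0 ord0 = - M ord0 ord0 by rewrite mxE mulN1r.
rewrite /qform !delta_qform (_ : T k j = T j k); last by rewrite -[in LHS]TT mxE.
by ring.
Qed.

(** The two forms differ by four times the entry, hence the factor 1/2 in the conclusion. *)
Lemma qform_sub_bound (R : realType) (p : nat) (S0 S1 : 'M[R]_p) (b : R) :
  S0^T = S0 -> S1^T = S1 ->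
  (forall j k, `|qform (S0 - S1) (delta_mx j ord0 + delta_mx k ord0)| <= b /\
               `|qform (S0 - S1) (delta_mx j ord0 - delta_mx k ord0)| <= b) ->
  forall j k, `|(S0 - S1) j k| <= b / 2.
Proof.
move=> ST0 ST1 H j k; have [] := H j k.
set D := S0 - S1 in H *; have DT : D^T = D by rewrite trmxB ST0 ST1.
clearbody D.
rewrite qform_deltaD// qform_deltaB// => H1 H2; move: H1 H2.
rewrite !ler_norml => /andP[? ?] /andP[? ?]; apply/andP; split; lra.
Qed.

(** Cauchy-Schwarz restricted to the support [W] of T: the factor is the square root of its
    cardinality instead of p, which is where sparsity pays. *)
Lemma tr_score_le (R : realType) (p : nat) (D T : 'M[R]_p) (b : R) (W : {set 'I_p * 'I_p}) :
  T^T = T -> 0 <= b -> (forall j k, `|D j k| <= b) ->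
  (forall j k, (j, k) \notin W -> T j k = 0) ->
  \tr (D *m T) <= b * Num.sqrt #|W|%:R * fro T.
Proof.
move=> TT b0 Db T0.
rewrite -[T in D *m T]TT mxtrace_mul_tr pair_big /=.
rewrite (bigID (mem W)) /= [X in _ + X]big1 ?addr0 => [|[j k] /T0 /= ->]; last by rewrite mulr0.
apply: le_trans (ler_norm _) _.
rewrite -(@ler_pXn2r _ 2) ?nnegrE ?mulr_ge0 ?fro_ge0 ?sqrtr_ge0// real_normK ?num_real//.
rewrite !exprMn sqr_fro sqr_sqrtr ?ler0n//.
apply: le_trans (cauchy_schwarz_sum _ _ _) _.
apply: ler_pM; rewrite ?sumr_ge0//.
- by move=> i _; rewrite sqr_ge0.
- by move=> i _; rewrite sqr_ge0.
- rewrite mulr_natr -sumr_const; apply: ler_sum => i _.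
  by rewrite -[leLHS]real_normK ?num_real// ler_pXn2r ?nnegrE.
- rewrite /fro2 pair_big /= [leRHS](bigID (mem W)) /= lerDl sumr_ge0// => i _.
  by rewrite sqr_ge0.
Qed.

(** An edge is stored once but occupies two entries of a symmetric matrix. *)
Lemma card_support_le (p : nat) (E1 E2 : {set 'I_p * 'I_p}) :
  (#|[set e : 'I_p * 'I_p | [|| e.1 == e.2, adj E1 e.1 e.2 | adj E2 e.1 e.2]]%SET|
    <= p + 2 * #|E1| + 2 * #|E2|)%N.
Proof.
pose sw (e : 'I_p * 'I_p) := (e.2, e.1).
have sub : [set e : 'I_p * 'I_p | [|| e.1 == e.2, adj E1 e.1 e.2 | adj E2 e.1 e.2]]%SET
  \subset ([set (j, j) | j : 'I_p] :|: (E1 :|: sw @: E1) :|: (E2 :|: sw @: E2))%SET.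
  apply/fintype.subsetP => -[j k]; rewrite !inE /adj /=.
  have swP (E : {set 'I_p * 'I_p}) : (k, j) \in E -> (j, k) \in sw @: E.
    by move=> H; apply/imsetP; exists (k, j).
  case/or3P => [/eqP ->|/orP[->|/swP ->]|/orP[->|/swP ->]]; rewrite ?orbT//.
  by rewrite imset_f.
apply: leq_trans (subset_leq_card sub) _.
have cU (A B : {set 'I_p * 'I_p}) a b : (#|A| <= a -> #|B| <= b -> #|A :|: B| <= a + b)%N.
  by move=> Aa Bb; apply: leq_trans (leq_card_setU _ _) _; exact: leq_add.
have cS (E : {set 'I_p * 'I_p}) : (#|E :|: sw @: E| <= 2 * #|E|)%N.
  by rewrite mul2n -addnn; apply: cU => //; exact: leq_imset_card.
apply: (cU _ _ _ _ _ (cS _)); apply: (cU _ _ _ _ _ (cS _)).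
by rewrite -[leqRHS]card_ord; exact: leq_imset_card.
Qed.

Lemma diag_le_sigma2_max (R : realType) (p : nat) (T : 'M[R]_p) j :
  (invmx T) j j <= sigma2_max T.
Proof. exact: (le_bigmax_cond _ (fun j => invmx T j j)). Qed.

Lemma theta_min_le (R : realType) (p : nat) (T : 'M[R]_p) (E : {set 'I_p * 'I_p}) e :
  e \in E -> theta_min T E <= `|T e.1 e.2|.
Proof. by move=> eE; exact: (bigmin_le_cond _ (fun e => `|T e.1 e.2|)). Qed.

Lemma posdef_diag_gt0 (R : realType) (p : nat) (T : 'M[R]_p) j : posdef T -> 0 < T j j.
Proof.
move=> Tpos; have := Tpos.2 (delta_mx j ord0).
rewrite trmx_delta -rowE -colE !mxE; apply.
by apply/eqP => /matrixP /(_ j ord0) /eqP; rewrite !mxE !eqxx oner_eq0.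
Qed.

Lemma fro2_delta (R : realType) (p : nat) (j : 'I_p) :
  fro2 (delta_mx j ord0 : 'cV[R]_p) = 1.
Proof. by rewrite fro2_col trmx_delta mul_delta_mx mxE !eqxx. Qed.

Lemma diag_le_lambda_max (R : realType) (p : nat) (T : 'M[R]_p) j : T^T = T ->
  T j j <= lambda_max T.
Proof.
move=> TT; have := qform_le_lambda_max (delta_mx j ord0) TT.
by rewrite fro2_delta mulr1 /qform trmx_delta -rowE -colE !mxE.
Qed.

Lemma entry_le_diag (R : realType) (p : nat) (T : 'M[R]_p) j k : T^T = T ->
  (forall x, 0 <= qform T x) -> 2 * `|T j k| <= T j j + T k k.
Proof.
move=> TT T0.
have := T0 (delta_mx j ord0 + delta_mx k ord0).
have := T0 (delta_mx j ord0 - delta_mx k ord0).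
rewrite qform_deltaD// qform_deltaB//.
by case: (ger0P (T j k)) => _; lra.
Qed.

Lemma edge_entry_neq0 (R : realType) (p : nat) (T : 'M[R]_p) (E : {set 'I_p * 'I_p}) e :
  exact_pattern T E -> is_edge_set E -> e \in E -> T e.1 e.2 != 0.
Proof.
move=> [_ pat] /forallP /(_ e) + eE; rewrite eE /= => lt.
rewrite pat /adj -?surjective_pairing ?eE//.
by apply/eqP => ee; rewrite ee ltnn in lt.
Qed.

(** The index [j] witnesses that p is positive; a matrix of size 0 has no eigenvalue. *)
Lemma lambda_max_gt0 (R : realType) (p : nat) (T : 'M[R]_p) (j : 'I_p) :
  posdef T -> 0 < lambda_max T.
Proof.
by move=> Tpos; apply: lt_le_trans (posdef_diag_gt0 j Tpos) (diag_le_lambda_max _ Tpos.1).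
Qed.

(** The upper bound comes from |T_jk| <= (T_jj + T_kk) / 2, so the ratio theta_0 / lambda_max that
    governs all rates lies in ]0, 1]. *)
Lemma theta_min_bounds (R : realType) (p : nat) (T : 'M[R]_p) (E : {set 'I_p * 'I_p}) e :
  posdef T -> exact_pattern T E -> is_edge_set E -> e \in E ->
  0 < theta_min T E <= lambda_max T.
Proof.
move=> Tpos pat sE eE; apply/andP; split.
  have e0 e' : e' \in E -> 0 < `|T e'.1 e'.2|.
    by move=> e'E; rewrite normr_gt0 (edge_entry_neq0 pat sE).
  (* The default value of the minimum must be positive as well; it is the largest entry over the
     edges, hence at least the one at [e]. *)
  apply: lt_bigmin => //; apply: lt_le_trans (e0 e eE) _.
  exact: (le_bigmax_cond _ (fun e => `|T e.1 e.2|)).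
apply: le_trans (theta_min_le T eE) _.
have psd x : 0 <= qform T x.
  have [->|/Tpos.2/ltW//] := eqVneq x 0.
  by rewrite /qform mulmx0 mxE.
have := entry_le_diag e.1 e.2 Tpos.1 psd.
have := diag_le_lambda_max e.1 Tpos.1; have := diag_le_lambda_max e.2 Tpos.1.
lra.
Qed.

(** * Exponential moments of independent standard normals *)

(** Tonelli applied to X as the integral over s >= 0 of the indicator of s < X. *)
Lemma integral_layer_cake (R : realType) (d : measure_display) (T : measurableType d)
  (mu : {sigma_finite_measure set T -> \bar R}) (W X : T -> R) :
  measurable_fun setT W -> (forall w, 0 <= W w) ->
  measurable_fun setT X -> (forall w, 0 <= X w) ->
  (\int[mu]_w (W w * X w)%:E =
   \int[lebesgue_measure]_s \int[mu]_w (W w * ((0 <= s) && (s < X w))%:R)%:E)%E.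
Proof.
move=> mW W0 mX X0.
pose b (z : T * measurableTypeR R) := (0 <= z.2) && (z.2 < X z.1).
pose K (z : T * measurableTypeR R) : R := W z.1 * (b z)%:R.
have mK : measurable_fun setT (EFin \o K).
  apply/measurable_EFinP; apply: measurable_funM.
    exact: measurableT_comp.
  apply: (@measurableT_comp _ _ _ _ _ _ (fun b : bool => b%:R : R) _ b) => //.
  apply: measurable_and; first exact: measurable_fun_ler.
  by apply: measurable_fun_ltr => //; exact: measurableT_comp.
have K0 z : (0 <= (EFin \o K) z)%E by rewrite lee_fin mulr_ge0.
rewrite [RHS](_ : _ = \int[mu]_w \int[lebesgue_measure]_s (K (w, s))%:E)%E; last first.
  exact/esym/(@fubini_tonelli _ _ T _ R mu (@lebesgue_measure R) _ mK K0).
apply: eq_integral => w _ /=.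
rewrite (_ : (fun s => _) = (fun s => (W w)%:E * (\1_(`[0, X w[%classic : set R) s)%:E)%E);
  last first.
  by apply/funext => s; rewrite indicE EFinM mem_setE in_itv.
rewrite ge0_integralZl//.
- rewrite integral_indic// setIT.
  have /= -> := @lebesgue_measure_itv R `[0, X w[; rewrite lte_fin.
  have [_|Xw] := ltP 0 (X w); first by rewrite sube0 EFinM.
  by rewrite (@le_anti _ _ (X w) 0) ?mulr0 ?mule0// Xw X0.
- exact/measurable_EFinP/measurable_indic.
- by rewrite lee_fin.
Qed.

(** The last hypothesis says that the images of the two weighted measures under [X1] and [X2] agree
    on Borel sets. This single form covers independence, integration against a density and transport
    of a law, according to the weights chosen. *)
Lemma eq_integral_weighted (R : realType) (d1 d2 : measure_display)
  (T1 : measurableType d1) (T2 : measurableType d2)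
  (mu1 : {sigma_finite_measure set T1 -> \bar R})
  (mu2 : {sigma_finite_measure set T2 -> \bar R})
  (W1 X1 : T1 -> R) (W2 X2 : T2 -> R) :
  measurable_fun setT W1 -> (forall w, 0 <= W1 w) ->
  measurable_fun setT X1 -> (forall w, 0 <= X1 w) ->
  measurable_fun setT W2 -> (forall w, 0 <= W2 w) ->
  measurable_fun setT X2 -> (forall w, 0 <= X2 w) ->
  (forall B, measurable B ->
    \int[mu1]_w (W1 w * \1_(X1 @^-1` B) w)%:E = \int[mu2]_w (W2 w * \1_(X2 @^-1` B) w)%:E)%E ->
  (\int[mu1]_w (W1 w * X1 w)%:E = \int[mu2]_w (W2 w * X2 w)%:E)%E.
Proof.
move=> mW1 W10 mX1 X10 mW2 W20 mX2 X20 H.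
rewrite !integral_layer_cake//; apply: eq_integral => s _.
have [s0|s0] /= := leP 0 s; last first.
  under eq_integral do rewrite mulr0.
  by under [in RHS]eq_integral do rewrite mulr0; rewrite !integral0.
have := H `]s, +oo[%classic (measurable_itv _).
have E T (X : T -> R) w : \1_(X @^-1` `]s, +oo[) w = ((s < X w)%R)%:R :> R.
  rewrite indicE; congr (nat_of_bool _)%:R.
  by apply/idP/idP => [/set_mem|sX]; [|apply/mem_set]; rewrite /= in_itv /= andbT.
under eq_integral do rewrite E.
by under [in X in _ = X -> _]eq_integral do rewrite E.
Qed.

Lemma integral_indep_mul (R : realType) (d : measure_display) (Omega : measurableType d)
  (P : probability Omega R) (W X : Omega -> R) (c : R) :
  measurable_fun setT W -> (forall w, 0 <= W w) ->
  measurable_fun setT X -> (forall w, 0 <= X w) -> 0 <= c ->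
  (forall B, measurable B ->
    \int[P]_w (W w * \1_(X @^-1` B) w)%:E = c%:E * P (X @^-1` B))%E ->
  (\int[P]_w (W w * X w)%:E = c%:E * \int[P]_w (X w)%:E)%E.
Proof.
move=> mW W0 mX X0 c0 H.
rewrite -ge0_integralZl//; first last.
- by move=> w _; rewrite lee_fin.
- exact/measurable_EFinP.
apply: (@eq_integral_weighted _ _ _ _ _ P P W X (cst c) X) => //.
move=> B mB; rewrite H// /cst; under [in RHS]eq_integral do rewrite EFinM.
have mXB : measurable (X @^-1` B) by rewrite -[X in measurable X]setTI; exact: mX.
rewrite ge0_integralZl//; first by rewrite integral_indic// setIT.
exact/measurable_EFinP/measurable_indic.
Qed.

Lemma integral_normal_prob (R : realType) (m s : R) (f : R -> R) :
  measurable_fun setT f -> (forall x, 0 <= f x) ->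
  (\int[normal_prob m s]_x (f x)%:E =
   \int[lebesgue_measure]_x (normal_pdf m s x * f x)%:E)%E.
Proof.
move=> mf f0; under eq_integral do rewrite -[f _]mul1r.
apply: (@eq_integral_weighted _ _ _ _ _ (normal_prob m s) lebesgue_measure (cst 1) f) => //.
- exact: measurable_normal_pdf.
- exact: normal_pdf_ge0.
move=> B mB; have mfB : measurable (f @^-1` B) by rewrite -[X in measurable X]setTI; exact: mf.
under eq_integral do rewrite mul1r.
rewrite integral_indic// setIT.
transitivity (\int[lebesgue_measure]_(x in f @^-1` B) (normal_pdf m s x)%:E)%E; first by [].
rewrite integral_mkcond.
 apply: eq_integral => x _; rewrite patchE indicE.
by case: (x \in _); rewrite ?mulr1 ?mulr0.
Qed.

Lemma integral_prod_indic (R : realType) (d : measure_display) (Omega : measurableType d)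
  (P : probability Omega R) (I : eqType) (Z : I -> Omega -> R) (K : seq I) (B : I -> set R) :
  iid_std_normal P Z -> uniq K -> (forall k, measurable (B k)) ->
  (\int[P]_w (\prod_(k <- K) \1_(Z k @^-1` B k) w)%:E =
   \big[*%E/1]_(k <- K) P (Z k @^-1` B k))%E.
Proof.
move=> [mZ [_ iZ]] uK mB; rewrite -iZ//.
rewrite -[[set k | k \in K]]/[set` K].
set A := \bigcap_(k in _) _.
have AE : A = \big[setI/setT]_(k <- K) (Z k @^-1` B k).
  rewrite /A; elim: (K) => [|k l IH]; first by rewrite big_nil; apply/seteqP; split.
  rewrite big_cons -IH; apply/seteqP; split=> [w H|w [Hk Hl] j /=].
    by split=> [|j /= jl]; apply: H; rewrite /= inE ?eqxx ?jl ?orbT.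
  by rewrite inE => /predU1P[->//|jl]; exact: Hl.
have mA : measurable A.
  rewrite AE; apply: big_rec => // k x _ mx; apply: measurableI => //.
  by rewrite -[X in measurable X]setTI; exact: mZ.
rewrite -[in RHS](setIT A) -integral_indic//; apply: eq_integral => w _; congr EFin.
rewrite AE; elim: (K) => [|k K' IH].
  by rewrite !big_nil indicE in_setT.
by rewrite !big_cons indicI /= IH.
Qed.


Lemma normal_pdf_expE (R : realType) (m s x : R) : s != 0 ->
  normal_pdf m s x = (Num.sqrt (s ^+ 2 * pi *+ 2))^-1 * expR (- (x - m) ^+ 2 / (s ^+ 2 *+ 2)).
Proof. by move=> s0; rewrite normal_pdfE. Qed.

(** Completing the square turns the tilted density into a multiple of the density of N(c, 1). *)
Lemma integral_pdf_tilt (R : realType) (c : R) :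
  (\int[lebesgue_measure]_x (normal_pdf 0 1 x * expR (c * x))%:E = (expR (c ^+ 2 / 2))%:E)%E.
Proof.
have E x : normal_pdf 0 1 x * expR (c * x) = expR (c ^+ 2 / 2) * normal_pdf c 1 x.
  rewrite !normal_pdf_expE ?oner_eq0// mulrCA -!mulrA -!expRD; congr (_ * expR _).
  by field.
under eq_integral do rewrite E EFinM.
rewrite ge0_integralZl//.
- by rewrite integral_normal_pdf mule1.
- by apply/measurable_EFinP; exact: measurable_normal_pdf.
- by move=> x _; rewrite lee_fin normal_pdf_ge0.
Qed.

(** The integrand is [r^-1] times the centred normal density of standard deviation [r^-1]. *)
Lemma integral_pdf_gauss (R : realType) (s : R) : s < 2^-1 ->
  (\int[lebesgue_measure]_x (normal_pdf 0 1 x * expR (s * x ^+ 2))%:E =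
   ((Num.sqrt (1 - 2 * s))^-1)%:E)%E.
Proof.
move=> s2; set r := Num.sqrt (1 - 2 * s).
have r0 : 0 < r by rewrite sqrtr_gt0; lra.
have r2 : r ^+ 2 = 1 - 2 * s by rewrite sqr_sqrtr//; lra.
have E x : normal_pdf 0 1 x * expR (s * x ^+ 2) = r^-1 * normal_pdf 0 r^-1 x.
  rewrite !normal_pdf_expE ?oner_eq0 ?invr_eq0 ?gt_eqF//.
  rewrite -mulrA -expRD mulrA; congr (_ * expR _); last first.
    by rewrite exprVn r2; field; rewrite gt_eqF//; lra.
  have Es (t : R) : 0 < t -> Num.sqrt (t ^+ 2 * pi *+ 2) = t * Num.sqrt (pi *+ 2).
    by move=> t0; rewrite -mulrnAr sqrtrM ?sqr_ge0// sqrtr_sqr gtr0_norm.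
  rewrite !Es ?invr_gt0//.
  by rewrite mul1r invfM invrK mulrA mulVf ?gt_eqF// mul1r.
under eq_integral do rewrite E EFinM.
rewrite ge0_integralZl//.
- by rewrite integral_normal_pdf mule1.
- by apply/measurable_EFinP; exact: measurable_normal_pdf.
- by move=> x _; rewrite lee_fin normal_pdf_ge0.
- by rewrite lee_fin invr_ge0 ltW.
Qed.

Lemma mgf_std_normal (R : realType) (d : measure_display) (Omega : measurableType d)
  (P : probability Omega R) (I : eqType) (Z : I -> Omega -> R) k c :
  iid_std_normal P Z -> (\int[P]_w (expR (c * Z k w))%:E = (expR (c ^+ 2 / 2))%:E)%E.
Proof.
move=> [mZ [dZ _]].
have me : measurable_fun setT (fun x : R => expR (c * x)).
  by apply: measurableT_comp => //; exact: measurable_funM.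
rewrite -integral_pdf_tilt -integral_normal_prob//.
under eq_integral do rewrite -[expR _]mul1r.
under [in RHS]eq_integral do rewrite -[expR _]mul1r.
apply: (@eq_integral_weighted _ _ _ _ _ P (normal_prob 0 1) (cst 1) (fun w => expR (c * Z k w)) (cst 1)) => //;
  try by move=> w; exact: expR_ge0.
  by apply: measurableT_comp => //; exact: measurable_funM.
move=> B mB.
under eq_integral do rewrite mul1r.
under [in RHS]eq_integral do rewrite mul1r.
set eB := (fun x => expR (c * x)) @^-1` B.
have meB : measurable eB by rewrite -[X in measurable X]setTI; exact: me.
rewrite !integral_indic//; last first.
  by rewrite -[X in measurable X]setTI; exact: (mZ k _ eB).
by rewrite !setIT; exact: dZ.
Qed.

(** Independence speaks of indicators, so they are exchanged for exponentials one coordinate at a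
    time, [K2] holding those not yet exchanged. To exchange k, the induction hypothesis is used with
    k moved to [K2] and an arbitrary Borel condition on its coordinate. *)
Lemma mgf_linear_aux (R : realType) (d : measure_display) (Omega : measurableType d)
  (P : probability Omega R) (I : eqType) (Z : I -> Omega -> R) (c : I -> R) (K K2 : seq I)
  (B : I -> set R) :
  iid_std_normal P Z -> uniq (K ++ K2) -> (forall k, measurable (B k)) ->
  (\int[P]_w (\prod_(k <- K) expR (c k * Z k w) * \prod_(k <- K2) \1_(Z k @^-1` B k) w)%:E =
   (\prod_(k <- K) expR (c k ^+ 2 / 2))%:E * \big[*%E/1]_(k <- K2) P (Z k @^-1` B k))%E.
Proof.
move=> iidZ; have [mZ [_ _]] := iidZ.
elim: K K2 B => [|k K IH] K2 B.
  move=> uK mB; rewrite big_nil mul1e -(integral_prod_indic iidZ)//.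
  by apply: eq_integral => w _; rewrite big_nil mul1r.
rewrite cat_cons => uK mB.
have uK2 : uniq (K ++ K2) by move: uK => /andP[].
have mE j : measurable_fun setT (fun w => expR (c j * Z j w)).
  by apply: measurableT_comp => //; exact: measurable_funM.
pose W w := \prod_(k <- K) expR (c k * Z k w) * \prod_(k <- K2) \1_(Z k @^-1` B k) w.
have fP j : P (Z j @^-1` B j) \is a fin_num.
  by apply: fin_num_measure; rewrite -[X in measurable X]setTI; exact: mZ.
pose Q := \prod_(k <- K2) fine (P (Z k @^-1` B k)).
have QE : (\big[*%E/1]_(k <- K2) P (Z k @^-1` B k))%E = Q%:E.
  rewrite /Q; elim: (K2) => [|j l IHl]; first by rewrite !big_nil.
  by rewrite !big_cons IHl EFinM fineK.
have -> : (\int[P]_w (\prod_(k <- k :: K) expR (c k * Z k w) *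
      \prod_(k <- K2) \1_(Z k @^-1` B k) w)%:E = \int[P]_w (W w * expR (c k * Z k w))%:E)%E.
  by apply: eq_integral => w _; rewrite big_cons /W -mulrA mulrC.
rewrite (@integral_indep_mul _ _ _ _ _ _ (\prod_(k <- K) expR (c k ^+ 2 / 2) * Q)).
- by rewrite mgf_std_normal// QE -!EFinM big_cons; congr EFin; ring.
- apply: measurable_funM; first exact: measurable_prod.
  apply: measurable_prod => j _; apply: measurable_indic.
  by rewrite -[X in measurable X]setTI; exact: mZ.
- by move=> w; rewrite mulr_ge0// prodr_ge0// => j _; rewrite expR_ge0.
- exact: mE.
- by move=> w; exact: expR_ge0.
- by rewrite mulr_ge0// prodr_ge0// => j _; rewrite ?expR_ge0// fine_ge0.
move=> B0 mB0.
set eB := (fun x => expR (c k * x)) @^-1` B0.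
have meB : measurable eB.
  rewrite -[X in measurable X]setTI.
  have me : measurable_fun setT (fun x : R => expR (c k * x)).
    by apply: measurableT_comp => //; exact: measurable_funM.
  exact: me.
(* The condition on coordinate [k] becomes the pullback of [B0] by the exponential; [k \notin K2]
   leaves the other conditions unchanged. *)
pose B' j := if j == k then eB else B j.
have kK2 : k \notin K2 by move: uK; rewrite /= mem_cat negb_or => /andP[/andP[]].
have := IH (k :: K2) B'.
rewrite (perm_uniq (_ : perm_eq _ (k :: K ++ K2))); last first.
  by apply/permPl; exact: (perm_catCA K [:: k] K2).
move=> /(_ uK).
rewrite !big_cons /B' eqxx.
have -> : (\big[*%E/1]_(j <- K2) P (Z j @^-1` (if j == k then eB else B j)) = Q%:E)%E.
  rewrite -QE; apply: eq_big_seq => j jK2.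
  by rewrite ifN//; apply: contraNneq kK2 => <-.
move=> H.
transitivity ((\prod_(k <- K) expR (c k ^+ 2 / 2))%:E * (P (Z k @^-1` eB) * Q%:E))%E; last first.
  by rewrite EFinM -muleA; congr (_ * _)%E; rewrite muleC.
rewrite -H; last by move=> j; case: ifP.
apply: eq_integral => w _; rewrite big_cons eqxx /W -!mulrA; congr (_ * _)%:E.
rewrite mulrC; congr (_ * _); apply: eq_big_seq => j jK2.
by rewrite ifN//; apply: contraNneq kK2 => <-.
Qed.

Lemma mgf_linear (R : realType) (d : measure_display) (Omega : measurableType d)
  (P : probability Omega R) (I : eqType) (Z : I -> Omega -> R) (c : I -> R) (K : seq I) :
  iid_std_normal P Z -> uniq K ->
  (\int[P]_w (expR (\sum_(k <- K) c k * Z k w))%:E =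
   (expR (\sum_(k <- K) c k ^+ 2 / 2))%:E)%E.
Proof.
move=> iidZ uK.
have := @mgf_linear_aux _ _ _ P _ Z c K [::] (fun=> setT) iidZ.
rewrite cats0 big_nil mule1 expR_sum => <-//.
by apply: eq_integral => w _; rewrite big_nil mulr1 expR_sum.
Qed.

(* Only the joint moment generating function of the G i is known, so a factor
   f (G i) can be integrated out only if f is, in the sense of the last
   hypothesis, a combination of exponentials. *)
Lemma integral_block_prod (R : realType) (d : measure_display) (Omega : measurableType d)
  (P : probability Omega R) (G : nat -> Omega -> R) (v K : R) (f : R -> R) :
  (forall i, measurable_fun setT (G i)) ->
  (forall n c, \int[P]_w (expR (\sum_(0 <= i < n) c i * G i w))%:E =
               (expR (\sum_(0 <= i < n) c i ^+ 2 * v / 2))%:E)%E ->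
  measurable_fun setT f -> (forall x, 0 <= f x) -> 0 <= K ->
  (forall (W X : Omega -> R) (w0 : R), 0 <= w0 ->
     measurable_fun setT W -> (forall w, 0 <= W w) -> measurable_fun setT X ->
     (forall c, \int[P]_w (W w * expR (c * X w))%:E = (w0 * expR (c ^+ 2 * v / 2))%:E)%E ->
     (\int[P]_w (W w * f (X w))%:E = (w0 * K)%:E)%E) ->
  forall n, (\int[P]_w (\prod_(0 <= i < n) f (G i w))%:E = (K ^+ n)%:E)%E.
Proof.
move=> mG mgf mf f0 K0 tr n.
(* The first m factors are already [f], the others still exponentials. The coefficients [c] stay
   arbitrary because changing the one at m yields every exponential moment of [G m] against the
   weight [W]. *)
have main m c : (m <= n)%N ->
  (\int[P]_w (\prod_(0 <= i < m) f (G i w) * expR (\sum_(m <= i < n) c i * G i w))%:E =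
   (K ^+ m * expR (\sum_(m <= i < n) c i ^+ 2 * v / 2))%:E)%E.
  elim: m c => [|m IH] c mn.
    rewrite expr0 mul1r -mgf; apply: eq_integral => w _.
    by rewrite big_nil mul1r.
  pose W w := \prod_(0 <= i < m) f (G i w) * expR (\sum_(m.+1 <= i < n) c i * G i w).
  transitivity (\int[P]_w (W w * f (G m w))%:E)%E.
    by apply: eq_integral => w _; rewrite big_nat_recr//= mulrAC.
  rewrite (tr W (G m) (K ^+ m * expR (\sum_(m.+1 <= i < n) c i ^+ 2 * v / 2)))//.
  - by rewrite exprSr mulrAC.
  - by rewrite mulr_ge0 ?exprn_ge0 ?expR_ge0.
  - apply: measurable_funM.
      by apply: measurable_prod => i _; exact: measurableT_comp.
    apply: measurableT_comp => //; apply: measurable_sum => i.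
    exact: measurable_funM.
  - by move=> w; rewrite mulr_ge0 ?expR_ge0// prodr_ge0.
  move=> c0; pose c' i := if i == m then c0 else c i.
  have E (F : R -> nat -> R) : \sum_(m <= i < n) F (c' i) i = F c0 m + \sum_(m.+1 <= i < n) F (c i) i.
    rewrite big_ltn// /c' eqxx; congr (_ + _).
    rewrite big_nat_cond [RHS]big_nat_cond; apply: eq_bigr => i /andP[/andP[mi _] _].
    by rewrite gtn_eqF.
  have := IH c' (ltnW mn).
  rewrite (E (fun x _ => x ^+ 2 * v / 2)) expRD mulrCA mulrC => H.
  rewrite -{}H; apply: eq_integral => w _.
  rewrite (E (fun x i => x * G i w)) expRD /W; congr (_ %:E); ring.
have := main n (fun=> 0) (leqnn n).
rewrite [in X in _ = X -> _]big_geq// expR0 mulr1 => <-.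
apply: eq_integral => w _; have -> : \sum_(n <= i < n) 0 * G i w = 0 by rewrite big_geq.
by rewrite expR0 mulr1.
Qed.

(* exp (s X^2) is a Gaussian mixture of the exponentials exp (g sqrt (2 s) X). *)
Lemma hubbard_stratonovich (R : realType) (d : measure_display) (Omega : measurableType d)
  (P : probability Omega R) (W X : Omega -> R) (w0 v s : R) :
  0 <= w0 -> 0 <= s -> s * v < 2^-1 ->
  measurable_fun setT W -> (forall w, 0 <= W w) -> measurable_fun setT X ->
  (forall c, \int[P]_w (W w * expR (c * X w))%:E = (w0 * expR (c ^+ 2 * v / 2))%:E)%E ->
  (\int[P]_w (W w * expR (s * X w ^+ 2))%:E = (w0 * (Num.sqrt (1 - 2 * (s * v)))^-1)%:E)%E.
Proof.
move=> w00 s0 sv mW W0 mX H.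
pose r := Num.sqrt (2 * s).
have r2 : r ^+ 2 = 2 * s by rewrite sqr_sqrtr// mulr_ge0.
pose F (z : Omega * measurableTypeR R) : R := W z.1 * (normal_pdf 0 1 z.2 * expR (r * X z.1 * z.2)).
have mF : measurable_fun setT (EFin \o F).
  apply/measurable_EFinP; apply: measurable_funM; first exact: measurableT_comp.
  apply: measurable_funM; first by apply: measurableT_comp => //; exact: measurable_normal_pdf.
  apply: measurableT_comp => //; apply: measurable_funM => //; apply: measurable_funM => //.
  exact: measurableT_comp.
have F0 z : (0 <= (EFin \o F) z)%E.
  by rewrite lee_fin mulr_ge0// mulr_ge0 ?normal_pdf_ge0 ?expR_ge0.
have mpe c : measurable_fun setT (fun x : R => normal_pdf 0 1 x * expR (c * x)).
  apply: measurable_funM; first exact: measurable_normal_pdf.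
  by apply: measurableT_comp => //; exact: measurable_funM.
transitivity (\int[P]_w \int[lebesgue_measure]_x (F (w, x))%:E)%E.
  apply: eq_integral => w _; rewrite /F /=.
  under eq_integral do rewrite EFinM.
  rewrite ge0_integralZl//.
  - by rewrite integral_pdf_tilt exprMn r2 EFinM; congr (_ * (expR _)%:E)%E; field.
  - by apply/measurable_EFinP; exact: mpe.
  - by move=> x _; rewrite lee_fin mulr_ge0 ?normal_pdf_ge0 ?expR_ge0.
  - by rewrite lee_fin.
(* Integrating over [Omega] first uses the hypothesis with coefficient [r * x], and leaves the
   one-dimensional Gaussian integral with parameter [s * v]. *)
have := @fubini_tonelli _ _ Omega _ R P (@lebesgue_measure R) (EFin \o F) mF F0.
move=> FT; transitivity (\int[lebesgue_measure]_x \int[P]_w (F (w, x))%:E)%E; first exact: FT.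
rewrite EFinM -integral_pdf_gauss// -ge0_integralZl//.
- apply: eq_integral => x _; rewrite /F /=.
  under eq_integral do rewrite mulrCA EFinM mulrAC.
  rewrite ge0_integralZl//.
  + rewrite H -!EFinM; congr EFin; rewrite mulrCA; congr (_ * (_ * expR _)).
    by rewrite exprMn r2; field.
  + apply/measurable_EFinP; apply: measurable_funM => //.
    by apply: measurableT_comp => //; exact: measurable_funM.
  + by move=> w _; rewrite lee_fin mulr_ge0 ?expR_ge0.
  + by rewrite lee_fin normal_pdf_ge0.
- apply/measurable_EFinP; apply: measurable_funM; first exact: measurable_normal_pdf.
  apply: measurableT_comp => //; apply: measurable_funM => //.
- by move=> x _; rewrite lee_fin mulr_ge0 ?normal_pdf_ge0 ?expR_ge0.
Qed.

(** Nonnegative coefficients allow additivity of nonnegative integrals, without integrability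
    conditions. *)
Lemma integral_exp_comb (R : realType) (d : measure_display) (Omega : measurableType d)
  (P : probability Omega R) (W X : Omega -> R) (w0 v : R) (l : seq (R * R)) :
  measurable_fun setT W -> (forall w, 0 <= W w) -> measurable_fun setT X ->
  (forall c, \int[P]_w (W w * expR (c * X w))%:E = (w0 * expR (c ^+ 2 * v / 2))%:E)%E ->
  all (fun ac => 0 <= ac.1) l ->
  (\int[P]_w (W w * \sum_(ac <- l) ac.1 * expR (ac.2 * X w))%:E =
   (w0 * \sum_(ac <- l) ac.1 * expR (ac.2 ^+ 2 * v / 2))%:E)%E.
Proof.
move=> mW W0 mX H; elim: l => [|ac l IH] /=.
  by rewrite big_nil mulr0 => _; under eq_integral do rewrite big_nil mulr0; rewrite integral0.
move=> /andP[a0 l0].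
have me c : measurable_fun setT (fun w => expR (c * X w)).
  by apply: measurableT_comp => //; exact: measurable_funM.
under eq_integral do rewrite big_cons mulrDr EFinD mulrCA EFinM.
have sum0 w : 0 <= \sum_(j <- l) j.1 * expR (j.2 * X w).
  rewrite big_seq sumr_ge0// => j jl; rewrite mulr_ge0 ?expR_ge0//.
  exact: (allP l0).
rewrite ge0_integralD//.
- rewrite IH// ge0_integralZl//.
  + by rewrite H big_cons mulrDr mulrCA EFinD EFinM.
  + by apply/measurable_EFinP; exact: measurable_funM.
  + by move=> w _; rewrite lee_fin mulr_ge0 ?expR_ge0.
- by move=> w _; rewrite -EFinM lee_fin !mulr_ge0 ?expR_ge0.
- apply/measurable_EFinP; apply: measurable_funM => //; exact: measurable_funM.
- by move=> w _; rewrite lee_fin mulr_ge0.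
- apply/measurable_EFinP; apply: measurable_funM => //.
  by apply: measurable_sum => j; exact: measurable_funM.
Qed.

(* f = 3 - 3 cosh (t x) + cosh (t x)^2, linearized. *)
Lemma integral_cosh_comb (R : realType) (d : measure_display) (Omega : measurableType d)
  (P : probability Omega R) (W X : Omega -> R) (w0 v t : R)
  (f := fun x => 7 / 2 - 3 / 2 * (expR (t * x) + expR (- t * x))
                 + 4^-1 * (expR (2 * t * x) + expR (- (2 * t) * x))) :
  (forall x, 0 <= f x) ->
  measurable_fun setT W -> (forall w, 0 <= W w) -> measurable_fun setT X ->
  (forall c, \int[P]_w (W w * expR (c * X w))%:E = (w0 * expR (c ^+ 2 * v / 2))%:E)%E ->
  (\int[P]_w (W w * f (X w))%:E =
   (w0 * (7 / 2 - 3 * expR (t ^+ 2 * v / 2) + 2^-1 * expR (4 * (t ^+ 2 * v / 2))))%:E)%E.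
Proof.
move=> f0 mW W0 mX H.
(* The negative terms are moved across: f plus the combination [l2] is the combination [l1], all
   three nonnegative, and the finite integral of [l2] is subtracted at the end. *)
pose l1 : seq (R * R) := [:: (7 / 2, 0); (4^-1, 2 * t); (4^-1, - (2 * t))].
pose l2 : seq (R * R) := [:: (3 / 2, t); (3 / 2, - t)].
have l10 : all (fun ac => 0 <= ac.1) l1 by rewrite /= !andbT; apply/and3P; split; lra.
have l20 : all (fun ac => 0 <= ac.1) l2 by rewrite /= !andbT; apply/andP; split; lra.
have I1 := integral_exp_comb mW W0 mX H l10.
have I2 := integral_exp_comb mW W0 mX H l20.
have me c : measurable_fun setT (fun w => expR (c * X w)).
  by apply: measurableT_comp => //; exact: measurable_funM.
have S : (\int[P]_w (W w * f (X w))%:E + \int[P]_w (W w * \sum_(ac <- l2) ac.1 * expR (ac.2 * X w))%:E =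
  \int[P]_w (W w * \sum_(ac <- l1) ac.1 * expR (ac.2 * X w))%:E)%E.
  rewrite -ge0_integralD//.
  - apply: eq_integral => w _; rewrite -EFinD -mulrDr; congr (_ * _)%:E.
    by rewrite /l1 /l2 !big_cons !big_nil /= /f mul0r expR0; field.
  - by move=> w _; rewrite lee_fin mulr_ge0.
  - apply/measurable_EFinP; apply: measurable_funM => //.
    apply: measurable_funD.
      by apply: measurable_funB => //; apply: measurable_funM => //; exact: measurable_funD.
    by apply: measurable_funM => //; exact: measurable_funD.
  - move=> w _; rewrite lee_fin mulr_ge0// big_seq sumr_ge0// => j jl.
    by rewrite mulr_ge0 ?expR_ge0//; exact: (allP l20).
  - apply/measurable_EFinP; apply: measurable_funM => //.
    by apply: measurable_sum => j; exact: measurable_funM.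
have -> : (\int[P]_w (W w * f (X w))%:E)%E =
  (w0 * \sum_(ac <- l1) ac.1 * expR (ac.2 ^+ 2 * v / 2) -
   w0 * \sum_(ac <- l2) ac.1 * expR (ac.2 ^+ 2 * v / 2))%:E.
  by rewrite EFinB -I1 -S I2 addeK.
congr EFin; rewrite /l1 /l2 !big_cons !big_nil /=.
have -> : (2 * t) ^+ 2 * v / 2 = 4 * (t ^+ 2 * v / 2) by field.
have -> : (- (2 * t)) ^+ 2 * v / 2 = 4 * (t ^+ 2 * v / 2) by field.
rewrite sqrrN expr0n /= !mul0r expR0; by field.
Qed.

(** * Inequalities for the hyperbolic cosine *)

Lemma ge0_derive_le (R : realType) (f f' : R -> R) (u : R) : 0 <= u ->
  (forall x : R, is_derive x 1 f (f' x)) -> (forall x, 0 <= x -> 0 <= f' x) -> f 0 <= f u.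
Proof.
move=> u0 df f'0.
have cf : {within `[0, u], continuous f}.
  apply: continuous_subspaceT => x; apply: differentiable_continuous.
  by apply/derivable1_diffP; have [] := df x.
have [c c0u fE] := MVT_segment u0 (fun x _ => df x) cf.
rewrite -subr_ge0 fE mulr_ge0 ?subr_ge0// f'0//.
by move: c0u; rewrite in_itv => /andP[].
Qed.

Lemma cosh_le_expR_sqr (R : realType) (u : R) :
  expR u + expR (- u) <= 2 * expR (u ^+ 2 / 2).
Proof.
wlog u0 : u / 0 <= u.
  move=> H; have [/H//|/ltW u0] := leP 0 u.
  by have := H (- u); rewrite opprK sqrrN addrC; apply; rewrite oppr_ge0.
(* [A u] is -2 cosh u exp (- u^2 / 2), with the sign that makes it nondecreasing for u >= 0. Its
   derivative has the sign of [B], which vanishes at 0 and has derivative x (e^x - e^-x) >= 0. *)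
pose B : R -> R := (cst 1 + id) * (expR \o -%R) - (cst 1 - id) * expR.
pose A : R -> R := - (expR \o (id - 2^-1 \*: (id ^+ 2))) - (expR \o (- id - 2^-1 \*: (id ^+ 2))).
have dB (x : R) : is_derive x 1 B (x * (expR x - expR (- x))).
  apply: is_derive_eq; rewrite /= /GRing.scale /= !fctE /=; ring.
have dA (x : R) : is_derive x 1 A (expR (- (x ^+ 2 / 2)) * B x).
  apply: is_derive_eq; rewrite /B /= /GRing.scale /= !fctE /GRing.scale /=.
  have -> : expR (x - 2^-1 * x ^+ 2) = expR (- (x ^+ 2 / 2)) * expR x.
    by rewrite -expRD; congr expR; field.
  have -> : expR (- x - 2^-1 * x ^+ 2) = expR (- (x ^+ 2 / 2)) * expR (- x).
    by rewrite -expRD; congr expR; field.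
  by field.
have B0 x : 0 <= x -> 0 <= B x.
  move=> x0; have := ge0_derive_le x0 dB.
  have -> : B 0 = 0 by rewrite /B !fctE /= oppr0 expR0; ring.
  by apply=> y y0; rewrite mulr_ge0// subr_ge0 ler_expR; lra.
have : A 0 <= A u.
  by apply: (ge0_derive_le u0 dA) => x x0; rewrite mulr_ge0 ?expR_ge0// B0.
have -> : A 0 = - 2.
  transitivity (- expR (0 - 2^-1 * 0 ^+ 2) - expR (- 0 - 2^-1 * 0 ^+ 2) : R); first by [].
  rewrite (_ : 0 - 2^-1 * 0 ^+ 2 = 0 :> R); last by ring.
  by rewrite (_ : - 0 - 2^-1 * 0 ^+ 2 = 0 :> R) ?expR0; ring.
rewrite /A !fctE /GRing.scale /= => H.
have E : expR (u - 2^-1 * u ^+ 2) + expR (- u - 2^-1 * u ^+ 2) <= 2 by lra.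
have -> : expR u + expR (- u) =
  (expR (u - 2^-1 * u ^+ 2) + expR (- u - 2^-1 * u ^+ 2)) * expR (u ^+ 2 / 2).
  by rewrite mulrDl -!expRD; congr (expR _ + expR _); field.
by rewrite ler_pM2r ?expR_gt0.
Qed.

(* With y = cosh (t x): exp (- (t x)^2 / 2) <= 1 / y <= 3 - 3 y + y^2. *)
Lemma cosh_comb_ge (R : realType) (t x : R) :
  expR (- (t ^+ 2 / 2 * x ^+ 2)) <=
  7 / 2 - 3 / 2 * (expR (t * x) + expR (- t * x))
                 + 4^-1 * (expR (2 * t * x) + expR (- (2 * t) * x)).
Proof.
have := cosh_le_expR_sqr (t * x).
rewrite mulNr (_ : 2 * t * x = t * x + t * x); last by ring.
rewrite (_ : - (2 * t) * x = - (t * x) + - (t * x)); last by ring.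
have -> : t ^+ 2 / 2 * x ^+ 2 = (t * x) ^+ 2 / 2 by field.
rewrite !expRD; set q := (t * x) ^+ 2 / 2.
rewrite (expRN q); have := expR_gt0 q; set e := expR q => e0.
have := expR_gt0 (t * x); have := expR_gt0 (- (t * x)).
have : expR (t * x) * expR (- (t * x)) = 1 by rewrite expRN mulfV ?gt_eqF ?expR_gt0.
set a := expR (t * x); set b := expR (- (t * x)) => ab b0 a0 abe.
set y := (a + b) / 2.
have y1 : 1 <= y.
  have := sqr_ge0 ((a - b) / 2).
  have y0 : 0 < y by rewrite /y; lra.
  have : y ^+ 2 = ((a - b) / 2) ^+ 2 + a * b by rewrite /y; field.
  rewrite ab => yy ab2; rewrite leNgt; apply/negP => yl; nra.
have yle : y <= e by rewrite /y; lra.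
have y0 : 0 < y by lra.
have ye : e^-1 <= y^-1 by rewrite lef_pV2.
apply: le_trans ye _.
have -> : 7 / 2 - 3 / 2 * (a + b) + 4^-1 * (a * a + b * b) = 3 - 3 * y + y ^+ 2.
  have -> : 3 - 3 * y + y ^+ 2 = 3 - 3 / 2 * (a + b) + 4^-1 * (a * a + b * b) + 2^-1 * (a * b).
    by rewrite /y; field.
  by rewrite ab; field.
rewrite -[leLHS]mul1r ler_pdivrMr; last by lra.
have -> : (3 - 3 * y + y ^+ 2) * y = 1 + (y - 1) ^+ 3 by ring.
by rewrite lerDl exprn_ge0// subr_ge0.
Qed.

(** * Chernoff bounds for sums of squares *)

Lemma prob_ge_le (R : realType) (d : measure_display) (Omega : measurableType d)
  (P : probability Omega R) (X : Omega -> R) (a M : R) :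
  measurable_fun setT X -> (forall w, 0 <= X w) -> 0 < a ->
  (\int[P]_w (X w)%:E <= M%:E)%E ->
  (P [set w | (a <= X w)%R] <= (M / a)%:E)%E.
Proof.
move=> mX X0 a0 XM; set A := [set w | _].
have mA : measurable A.
  have := measurable_fun_ler (measurable_cst a) mX.
  move=> /(_ measurableT [set true]); rewrite setTI; apply.
  by [].
rewrite EFinM lee_pdivlMr// (le_trans _ XM)//.
have -> : (P A * a%:E = \int[P]_w (a * \1_A w)%:E)%E.
  under eq_integral do rewrite EFinM.
  rewrite ge0_integralZl//; first by rewrite integral_indic// setIT muleC.
  - exact/measurable_EFinP/measurable_indic.
  - by rewrite lee_fin ltW.
apply: ge0_le_integral => //.
- by move=> w _; rewrite lee_fin mulr_ge0// ltW.
- apply/measurable_EFinP; apply: measurable_funM => //; exact: measurable_indic.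
- exact/measurable_EFinP.
- move=> w _; rewrite lee_fin indicE; case: (boolP (w \in A)) => [/set_mem|_].
    by rewrite mulr1.
  by rewrite mulr0.
Qed.

Lemma chi2_mgf_pos (R : realType) (d : measure_display) (Omega : measurableType d)
  (P : probability Omega R) (G : nat -> Omega -> R) (v s : R) (n : nat) :
  (forall i, measurable_fun setT (G i)) ->
  (forall n c, \int[P]_w (expR (\sum_(0 <= i < n) c i * G i w))%:E =
               (expR (\sum_(0 <= i < n) c i ^+ 2 * v / 2))%:E)%E ->
  0 <= v -> 0 <= s -> s * v <= 8^-1 ->
  (\int[P]_w (expR (s * \sum_(0 <= i < n) G i w ^+ 2))%:E <=
   (expR (n%:R * (s * v + 16 * (s * v) ^+ 2)))%:E)%E.
Proof.
move=> mG mgf v0 s0; set tau := s * v => sv.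
have tau0 : 0 <= tau by exact: mulr_ge0.
pose K := (Num.sqrt (1 - 2 * tau))^-1.
have K0 : 0 <= K by rewrite invr_ge0 sqrtr_ge0.
have KE : K <= expR (tau + 16 * tau ^+ 2).
  have s1 : 0 < 1 - 2 * tau by lra.
  rewrite /K -[leRHS]invrK -expRN lef_pV2 ?posrE ?expR_gt0 ?sqrtr_gt0//.
  rewrite -(@ler_pXn2r _ 2) ?nnegrE ?sqrtr_ge0 ?expR_ge0// sqr_sqrtr; last by lra.
  have -> : expR (- (tau + 16 * tau ^+ 2)) ^+ 2 = (expR (2%:R * (tau + 16 * tau ^+ 2)))^-1.
    by rewrite -expRN -mulrN -expRM_natl.
  have := expR_ge1Dx (2%:R * (tau + 16 * tau ^+ 2)); set e := expR _ => e1.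
  have e0 : 0 < e by exact: expR_gt0.
  have e2 : 1 + 2 * tau + 32 * tau ^+ 2 <= e by lra.
  (* After squaring, [1 + x <= expR x] suffices because 16 is generous; the same constant serves the
     opposite sign, where it is dictated by the expansion of [K]. *)
  have : (1 - 2 * tau) * (1 + 2 * tau + 32 * tau ^+ 2) >= 1.
    have -> : (1 - 2 * tau) * (1 + 2 * tau + 32 * tau ^+ 2) = 1 + tau ^+ 2 * (28 - 64 * tau) by ring.
    by rewrite lerDl mulr_ge0 ?sqr_ge0//; lra.
  rewrite -[e^-1]mul1r ler_pdivrMr// => /le_trans; apply.
  by rewrite ler_wpM2l//; lra.
have fE w : expR (s * \sum_(0 <= i < n) G i w ^+ 2) =
    \prod_(0 <= i < n) expR (s * G i w ^+ 2).
  by rewrite mulr_sumr expR_sum.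
under eq_integral do rewrite fE.
rewrite (@integral_block_prod _ _ _ P G v K (fun x => expR (s * x ^+ 2)))//.
- by rewrite lee_fin expRM_natl lerXn2r// ?nnegrE// expR_ge0.
- apply: measurableT_comp => //; apply: measurable_funM => //; exact: measurable_funX.
- by move=> W X w0 w00 mW W0 mX H; apply: hubbard_stratonovich => //; rewrite -/tau; lra.
Qed.

Lemma chi2_mgf_neg (R : realType) (d : measure_display) (Omega : measurableType d)
  (P : probability Omega R) (G : nat -> Omega -> R) (v s : R) (n : nat) :
  (forall i, measurable_fun setT (G i)) ->
  (forall n c, \int[P]_w (expR (\sum_(0 <= i < n) c i * G i w))%:E =
               (expR (\sum_(0 <= i < n) c i ^+ 2 * v / 2))%:E)%E ->
  0 <= v -> 0 <= s -> s * v <= 8^-1 ->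
  (\int[P]_w (expR (- s * \sum_(0 <= i < n) G i w ^+ 2))%:E <=
   (expR (n%:R * (- (s * v) + 16 * (s * v) ^+ 2)))%:E)%E.
Proof.
move=> mG mgf v0 s0; set tau := s * v => sv.
have tau0 : 0 <= tau by exact: mulr_ge0.
pose t := Num.sqrt (2 * s).
have t2 : t ^+ 2 / 2 = s by rewrite sqr_sqrtr ?mulr_ge0//; field.
pose f x := 7 / 2 - 3 / 2 * (expR (t * x) + expR (- t * x))
                 + 4^-1 * (expR (2 * t * x) + expR (- (2 * t) * x)).
have f0 x : 0 <= f x by apply: le_trans (cosh_comb_ge t x); exact: expR_ge0.
have fE w : expR (- s * \sum_(0 <= i < n) G i w ^+ 2) <= \prod_(0 <= i < n) f (G i w).
  rewrite mulr_sumr expR_sum; apply: ler_prod => i _; rewrite expR_ge0 /=.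
  by apply: le_trans (cosh_comb_ge t _); rewrite t2 mulNr.
have mf : measurable_fun setT f.
  have me (c : R) : measurable_fun setT (fun x : R => expR (c * x)).
    by apply: measurableT_comp => //; exact: measurable_funM.
  apply: measurable_funD.
    by apply: measurable_funB => //; apply: measurable_funM => //; exact: measurable_funD.
  by apply: measurable_funM => //; exact: measurable_funD.
pose K := 7 / 2 - 3 * expR tau + 2^-1 * expR (4 * tau).
have KE : K <= expR (- tau + 16 * tau ^+ 2).
  apply: le_trans (expR_ge1Dx _).
  have e1 := expR_ge1Dx tau.
  (* The source of 16, as half of 32, and of the threshold 1/8: [16 - 128 * tau] is nonnegative
     exactly for tau <= 1/8. The linear terms of [K] add up to [- tau]. *)
  have e4 : expR (4 * tau) <= 1 + 4 * tau + 32 * tau ^+ 2.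
    have := expR_ge1Dx (- (4 * tau)); rewrite expRN.
    have := expR_gt0 (4 * tau); set e := expR (4 * tau) => e0 h.
    have : e * (1 - 4 * tau) <= 1 by rewrite -ler_pdivlMl// mulr1.
    have : 1 <= (1 + 4 * tau + 32 * tau ^+ 2) * (1 - 4 * tau).
      have -> : (1 + 4 * tau + 32 * tau ^+ 2) * (1 - 4 * tau) = 1 + tau ^+ 2 * (16 - 128 * tau) by ring.
      by rewrite lerDl mulr_ge0 ?sqr_ge0//; lra.
    move=> /[swap] /le_trans /[apply]; rewrite ler_pM2r//; lra.
  by rewrite /K; lra.
have KI (W X : Omega -> R) (w0 : R) : 0 <= w0 -> measurable_fun setT W -> (forall w, 0 <= W w) ->
    measurable_fun setT X ->
    (forall c, \int[P]_w (W w * expR (c * X w))%:E = (w0 * expR (c ^+ 2 * v / 2))%:E)%E ->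
    (\int[P]_w (W w * f (X w))%:E = (w0 * K)%:E)%E.
  move=> w00 mW W0 mX H; rewrite (integral_cosh_comb f0 mW W0 mX H).
  by rewrite (_ : t ^+ 2 * v / 2 = tau)// /tau -[in RHS]t2; field.
(* [K] is the expectation of the nonnegative [f (G 0)]; its sign is needed to raise the bound on [K]
   to the power n. *)
have K0 : 0 <= K.
  have H1 c : (\int[P]_w (1 * expR (c * G 0 w))%:E = (1 * expR (c ^+ 2 * v / 2))%:E)%E.
    have := mgf 1 (fun=> c); rewrite big_nat1 mul1r => <-.
    by apply: eq_integral => w _; rewrite big_nat1 mul1r.
  have := KI (cst 1) (G 0) 1 ler01 (measurable_cst _) (fun=> ler01) (mG 0) H1.
  rewrite mul1r -lee_fin => <-.
  by apply: integral_ge0 => w _; rewrite lee_fin mul1r.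
apply: (@le_trans _ _ (\int[P]_w (\prod_(0 <= i < n) f (G i w))%:E)%E).
  apply: ge0_le_integral => //.
  - apply/measurable_EFinP; apply: measurableT_comp => //; apply: measurable_funM => //.
    by apply: measurable_sum => i; exact: measurable_funX.
  - by apply/measurable_EFinP; apply: measurable_prod => i _; exact: measurableT_comp.
  - by move=> w _; rewrite lee_fin fE.
rewrite (@integral_block_prod _ _ _ P G v K f)//.
by rewrite lee_fin expRM_natl lerXn2r// ?nnegrE// expR_ge0.
Qed.

Lemma chi2_tail (R : realType) (d : measure_display) (Omega : measurableType d)
  (P : probability Omega R) (G : nat -> Omega -> R) (v b r : R) (n : nat) :
  (forall i, measurable_fun setT (G i)) ->
  (forall n c, \int[P]_w (expR (\sum_(0 <= i < n) c i * G i w))%:E =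
               (expR (\sum_(0 <= i < n) c i ^+ 2 * v / 2))%:E)%E ->
  0 <= v <= b -> 0 < b -> 0 <= r <= 4 ->
  (P [set w | (n%:R * (b * r) <= `|\sum_(0 <= i < n) G i w ^+ 2 - n%:R * v|)%R] <=
   (2 * expR (- (n%:R * r ^+ 2 / 64)))%:E)%E.
Proof.
move=> mG mgf /andP[v0 vb] b0 /andP[r0 r4].
(* The value r / 32 of [s * b] minimizes 16 (s b)^2 - s b r, with minimum - r^2 / 64; [r <= 4] keeps
   [s * v] below the threshold 1/8. *)
pose s := r / (32 * b).
have s0 : 0 <= s by rewrite divr_ge0// ltW// mulr_gt0.
have sb : s * b = r / 32 by rewrite /s; field; rewrite gt_eqF.
have sv : s * v <= r / 32 by rewrite -sb ler_wpM2l.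
have sv0 : 0 <= s * v by exact: mulr_ge0.
have sv8 : s * v <= 8^-1 by lra.
pose Q w := \sum_(0 <= i < n) G i w ^+ 2.
have mQ : measurable_fun setT Q by apply: measurable_sum => i; exact: measurable_funX.
have mE c : measurable_fun setT (fun w => expR (c * Q w)).
  by apply: measurableT_comp => //; exact: measurable_funM.
pose c := expR (- (n%:R * r ^+ 2 / 64)).
have cE : n%:R * (16 * (s * v) ^+ 2 - s * (b * r)) <= - (n%:R * r ^+ 2 / 64).
  rewrite (_ : s * (b * r) = r / 32 * r); last by rewrite mulrA sb.
  have -> : - (n%:R * r ^+ 2 / 64) = n%:R * - (r ^+ 2 / 64) by field.
  rewrite ler_wpM2l ?ler0n//.
  have : (s * v) ^+ 2 <= (r / 32) ^+ 2.
    by rewrite ler_pXn2r// nnegrE//; lra.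
  lra.
(* [sg] is 1 for the upper tail and -1 for the lower one. *)
have tail (sg : R) (A := [set w | expR (sg * s * (n%:R * v) + n%:R * (s * (b * r))) <= expR (sg * s * Q w)]) :
  (\int[P]_w (expR (sg * s * Q w))%:E <= (expR (n%:R * (sg * (s * v) + 16 * (s * v) ^+ 2)))%:E)%E ->
  (P A <= c%:E)%E.
  move=> /(prob_ge_le (mE _) (fun w => expR_ge0 _) (expR_gt0 _)) H.
  apply: le_trans (H _) _; rewrite lee_fin -expRN -expRD ler_expR.
  by apply: le_trans cE; rewrite le_eqVlt; apply/orP; left; apply/eqP; ring.
pose A1 := [set w | expR (1 * s * (n%:R * v) + n%:R * (s * (b * r))) <= expR (1 * s * Q w)].
pose A2 := [set w | expR (-1 * s * (n%:R * v) + n%:R * (s * (b * r))) <= expR (-1 * s * Q w)].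
have mA (e f : R) : measurable [set w | expR e <= expR (f * Q w)].
  have := measurable_fun_ler (measurable_cst (expR e)) (mE f).
  by move=> /(_ measurableT [set true]); rewrite setTI; apply.
have PA1 : (P A1 <= c%:E)%E.
  apply: tail; under eq_integral do rewrite mul1r.
  by rewrite mul1r; exact: chi2_mgf_pos.
have PA2 : (P A2 <= c%:E)%E.
  apply: tail; under eq_integral do rewrite mulN1r.
  by rewrite mulN1r; exact: chi2_mgf_neg.
set A := [set w | _].
have mAA : measurable A.
  have mN : measurable_fun setT (fun w => `|Q w - n%:R * v|).
    by apply: measurableT_comp => //; exact: measurable_funB.
  have := measurable_fun_ler (measurable_cst (n%:R * (b * r))) mN.
  by move=> /(_ measurableT [set true]); rewrite setTI; apply.
have AA : A `<=` A1 `|` A2.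
  move=> w; rewrite /A /A1 /A2 /= -/(Q w) !ler_expR; case: (ger0P (Q w - n%:R * v)) => _ H.
    by left; have := ler_wpM2l s0 H; lra.
  by right; have := ler_wpM2l s0 H; lra.
apply: (@le_trans _ _ (P (A1 `|` A2))).
  by apply: le_measure; rewrite ?inE//; apply: measurableU; exact: mA.
apply: le_trans (measureU2 _ _ _) _; try exact: mA.
by rewrite mulr_natl mulr2n EFinD leeD.
Qed.

(** * Uniform deviation of the sample covariance *)

(** Linear forms with common coefficients [a] in the different rows have the joint moment generating
    function of independent centred normals of variance |a|^2, which is what the chi-square bounds
    ask for. *)
Lemma mgf_rows (R : realType) (d : measure_display) (Omega : measurableType d)
  (P : probability Omega R) (Z : nat * nat -> Omega -> R) (p n : nat) (a c : nat -> R) :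
  iid_std_normal P Z ->
  (\int[P]_w (expR (\sum_(0 <= i < n) c i * \sum_(0 <= j < p) a j * Z (i, j) w))%:E =
   (expR (\sum_(0 <= i < n) c i ^+ 2 * (\sum_(0 <= j < p) a j ^+ 2) / 2))%:E)%E.
Proof.
move=> iidZ.
pose K := [seq (i, j) | i <- index_iota 0 n, j <- index_iota 0 p].
have uK : uniq K by rewrite allpairs_uniq ?iota_uniq// => -[? ?] [? ?] _ _ [-> ->].
have := mgf_linear (fun k => c k.1 * a k.2) iidZ uK.
rewrite big_allpairs /= => H.
have -> : \sum_(0 <= i < n) c i ^+ 2 * (\sum_(0 <= j < p) a j ^+ 2) / 2 =
    \sum_(0 <= i < n) \sum_(0 <= j < p) (c i * a j) ^+ 2 / 2.
  apply: eq_bigr => i _; rewrite -mulrA mulr_suml mulr_sumr; apply: eq_bigr => j _.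
  by rewrite exprMn mulrA.
rewrite -H; apply: eq_integral => w _; rewrite big_allpairs /=.
congr (expR _)%:E; apply: eq_bigr => i _; rewrite mulr_sumr; apply: eq_bigr => j _.
by rewrite mulrA.
Qed.

Lemma qform_sample_cov (R : realType) (p n : nat) (X : 'I_n -> 'cV[R]_p) u :
  qform (sample_cov X) u = n%:R^-1 * \sum_(i < n) (u^T *m X i) ord0 ord0 ^+ 2.
Proof.
rewrite /qform /sample_cov -scalemxAr -scalemxAl mxE mulmx_sumr mulmx_suml summxE.
congr (_ * _); apply: eq_bigr => i _.
have -> : u^T *m (X i *m (X i)^T) *m u = (u^T *m X i) *m (u^T *m X i)^T.
  by rewrite trmx_mul trmxK !mulmxA.
by rewrite [LHS]mxE big_ord1 [X in _ * X]mxE expr2.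
Qed.

Lemma sample_cov_sym (R : realType) (p n : nat) (X : 'I_n -> 'cV[R]_p) :
  (sample_cov X)^T = sample_cov X.
Proof.
rewrite /sample_cov trmxZ raddf_sum /=; congr (_ *: _); apply: eq_bigr => i _.
by rewrite trmx_mul trmxK.
Qed.

Lemma sample_cov_tail (R : realType) (d : measure_display) (Omega : measurableType d)
  (P : probability Omega R) (Z : nat * nat -> Omega -> R) (p n : nat) (L : 'M[R]_p)
  (u : 'cV[R]_p) (b r : R)
  (A := [set w | b * r <= `|qform (L *m L^T -
           sample_cov (fun i : 'I_n => sample L Z w i)) u| ]) :
  iid_std_normal P Z -> (0 < n)%N ->
  qform (L *m L^T) u <= b -> 0 < b -> 0 <= r <= 4 ->
  measurable A /\ (P A <= (2 * expR (- (n%:R * r ^+ 2 / 64)))%:E)%E.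
Proof.
move=> iidZ n0 vb b0 r04; have [mZ _] := iidZ.
(* The coefficients of u^T L, extended by 0 since the coordinates of [Z] are indexed by naturals. *)
pose a k := if insub k is Some j then (L^T *m u) j ord0 else 0.
have aE (j : 'I_p) : a j = (L^T *m u) j ord0 by rewrite /a valK.
pose G i w := \sum_(0 <= j < p) a j * Z (i, j) w.
have mG i : measurable_fun setT (G i).
  by apply: measurable_sum => j; exact: measurable_funM.
pose v := \sum_(0 <= j < p) a j ^+ 2.
have vE : qform (L *m L^T) u = v.
  rewrite qform_gram /fro2 /v big_mkord; apply: eq_bigr => j _.
  by rewrite big_ord1 aE.
have GE i w : (u^T *m sample L Z w i) ord0 ord0 = G i w.
  rewrite /sample mulmxA /G big_mkord.
  have -> : u^T *m L = (L^T *m u)^T by rewrite trmx_mul trmxK.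
  rewrite mxE; apply: eq_bigr => j _.
  by rewrite [(_^T) _ _]mxE -aE [(\matrix_(_, _) _) _ _]mxE.
have n0R : (0 : R) < n%:R by rewrite ltr0n.
have AE : A = [set w | n%:R * (b * r) <= `|\sum_(0 <= i < n) G i w ^+ 2 - n%:R * v| ].
  apply/funext => w; rewrite /A /=; apply/propext.
  rewrite qformB vE qform_sample_cov distrC.
  have -> : n%:R^-1 * (\sum_(i < n) (u^T *m sample L Z w i) ord0 ord0 ^+ 2) - v =
     n%:R^-1 * (\sum_(0 <= i < n) G i w ^+ 2 - n%:R * v).
    rewrite big_mkord; under eq_bigr do rewrite GE.
    by field; rewrite gt_eqF.
  by rewrite normrM gtr0_norm ?invr_gt0// ler_pdivlMl.
rewrite AE; split.
  have mN : measurable_fun setT (fun w => `|\sum_(0 <= i < n) G i w ^+ 2 - n%:R * v|).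
    apply: measurableT_comp => //; apply: measurable_funB => //.
    by apply: measurable_sum => i; exact: measurable_funX.
  have := measurable_fun_ler (measurable_cst (n%:R * (b * r))) mN.
  by move=> /(_ measurableT [set true]); rewrite setTI; apply.
apply: (@chi2_tail _ _ _ P G v b r n mG) => //.
- by move=> m c; exact: mgf_rows.
- by rewrite -vE vb vE sumr_ge0// => j _; exact: sqr_ge0.
Qed.

Lemma measure_bigsetU_le (R : realType) (d : measure_display) (T : measurableType d)
  (mu : {measure set T -> \bar R}) (I : finType) (F : I -> set T) (c : \bar R) :
  (forall i, measurable (F i)) -> (forall i, mu (F i) <= c)%E ->
  measurable (\big[setU/set0]_i F i) /\
  (mu (\big[setU/set0]_i F i) <= \sum_(i : I) c)%E.
Proof.
move=> mF Fc; apply: (big_ind2 (fun X y => measurable X /\ (mu X <= y)%E)).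
- by rewrite measure0.
- move=> X x Y y [mX Xx] [mY Yy]; split; first exact: measurableU.
  by apply: le_trans (measureU2 _ mX mY) _; exact: leeD.
- by [].
Qed.

Lemma sample_cov_uniform (R : realType) (d : measure_display) (Omega : measurableType d)
  (P : probability Omega R) (Z : nat * nat -> Omega -> R) (p n : nat) (L : 'M[R]_p)
  (s2 r : R) (S := fun w => sample_cov (fun i : 'I_n => sample L Z w i)) :
  iid_std_normal P Z -> (0 < n)%N -> (0 < p)%N ->
  0 < s2 -> (forall j, (L *m L^T) j j <= s2) -> 0 <= r <= 4 ->
  3 * ln p%:R <= n%:R * r ^+ 2 / 64 ->
  exists A : set Omega, [/\ measurable A,
    (forall w, A w -> forall j k, `|(L *m L^T - S w) j k| <= 2 * s2 * r) &
    ((1 - 4 / p%:R)%:E <= P A)%E].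
Proof.
move=> iidZ n0 p0 s20 Ls r04 rp.
have ST (M : 'M[R]_p) : (M *m M^T)^T = M *m M^T by rewrite trmx_mul trmxK.
pose u (t : 'I_p * 'I_p * bool) : 'cV[R]_p :=
  if t.2 then delta_mx t.1.1 ord0 + delta_mx t.1.2 ord0 else delta_mx t.1.1 ord0 - delta_mx t.1.2 ord0.
pose F t := [set w | 4 * s2 * r <= `|qform (L *m L^T - S w) (u t)| ].
(* The variance along e_j + e_k or e_j - e_k is at most twice the sum of two diagonal entries. *)
have ub t : qform (L *m L^T) (u t) <= 4 * s2.
  have q0 x : 0 <= qform (L *m L^T) x by rewrite qform_gram fro2_ge0.
  move: t => [[j k] sg]; have := entry_le_diag j k (ST L) q0.
  rewrite /u /=; have := Ls j; have := Ls k.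
  case: sg; rewrite ?qform_deltaD ?qform_deltaB//.
    by have := ler_norm ((L *m L^T) j k); lra.
  by have := ler_norm (- (L *m L^T) j k); rewrite normrN; lra.
have s40 : 0 < 4 * s2 by lra.
have tail t := sample_cov_tail iidZ n0 (ub t) s40 r04.
have [mB PB] := measure_bigsetU_le (fun t => (tail t).1) (fun t => (tail t).2).
set B := \big[setU/set0]_i _ in mB PB.
exists (~` B); split; first exact: measurableC.
- move=> w Bw j k; rewrite (_ : 2 * s2 * r = (4 * s2 * r) / 2); last by field.
  apply: qform_sub_bound; [exact: ST|exact: sample_cov_sym|].
  have nF t : ~ F t w.
    by move=> Ft; apply: Bw; rewrite /B (bigD1 t)//; left.
  move=> j' k'; split; rewrite leNgt; apply/negP => /ltW.
    exact: (nF (j', k', true)).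
  exact: (nF (j', k', false)).
- rewrite probability_setC//.
  have p0R : (0 : R) < p%:R by rewrite ltr0n.
  rewrite EFinB leeB//; apply: le_trans PB _.
  (* There are 2 p^2 directions, each failing with probability at most 2 / p^3; this is why the
     exponent has to reach 3 ln p. *)
  rewrite sumEFin lee_fin sumr_const !card_prod !card_ord card_bool.
  have : expR (- (n%:R * r ^+ 2 / 64)) <= (p%:R ^+ 3)^-1.
    rewrite expRN lef_pV2 ?posrE ?expR_gt0 ?exprn_gt0//.
    rewrite -[p%:R in leLHS]lnK ?posrE// -expRM_natl ler_expR; lra.
  move=> H; rewrite -[leLHS]mulr_natl !natrM.
  have := ler_wpM2l (mulr_ge0 (mulr_ge0 (ltW p0R) (ltW p0R)) (ler0n _ 4)) H.
  rewrite (_ : p%:R * p%:R * 4 * (p%:R ^+ 3)^-1 = 4 / p%:R); first lra.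
  by field; rewrite gt_eqF.
Qed.

(** * The likelihood gap under an entrywise deviation bound *)

Lemma loglik_gap (R : realType) (p q n : nat) (E0 E : {set 'I_p * 'I_p})
  (T0 L S T : 'M[R]_p) (C r : R) (l := lambda_max T0) (th := theta_min T0 E0) :
  posdef T0 -> exact_pattern T0 E0 -> L *m L^T = invmx T0 ->
  is_edge_set E0 -> (#|E0| <= q)%N -> is_edge_set E -> ~~ (E0 \subset E) -> (#|E| <= q)%N ->
  sigma2_max T0 * l <= C -> 0 <= r ->
  (forall j k, `|(invmx T0 - S) j k| <= 2 * sigma2_max T0 * r) ->
  2 * C * r * Num.sqrt (p + 4 * q)%:R <= th / l / 16 ->
  in_model E T ->
  n%:R * (th / l) ^+ 2 / 32 <= loglik n S T0 - loglik n S T.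
Proof.
move=> T0pos pat LL eE0 cE0 eE EE0 cE sl r0 Sb rq [Tpos Tz].
have /subsetPn [e eE0' eNE] := EE0.
have elt : (e.1 < e.2)%N by move/forallP: eE0 => /(_ e); rewrite eE0'.
have Te : T e.1 e.2 = 0.
  apply: Tz; first by apply/eqP => ee; rewrite ee ltnn in elt.
  rewrite /adj -surjective_pairing (negbTE eNE) /=; apply/negP => H.
  by move/forallP: eE => /(_ (e.2, e.1)); rewrite H /= ltnNge (ltnW elt).
have /andP[th0 thl] : 0 < th <= l by exact: theta_min_bounds eE0'.
have the : th <= `|T0 e.1 e.2| := theta_min_le _ eE0'.
have l0 : 0 < l := lambda_max_gt0 e.1 T0pos.
set y := th / l in rq *.
have y0 : 0 < y by rewrite divr_gt0.
have y1 : y <= 1 by rewrite ler_pdivrMr// mul1r.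
pose N := fro (T - T0); pose x := N / l.
(* The entry at [e], an edge of [E0] missing from [E], already contributes theta_0. *)
have yx : y <= x.
  rewrite ler_pM2r ?invr_gt0//; apply: le_trans the _.
  rewrite -(@ler_pXn2r _ 2) ?nnegrE ?fro_ge0// sqr_fro real_normK ?num_real//.
  rewrite /fro2 pair_big /= (bigD1 e)//= !mxE Te sub0r sqrrN lerDl.
  by apply: sumr_ge0 => i _; exact: sqr_ge0.
have loss : x ^+ 2 / (4 * (1 + x)) <= \tr (invmx T0 *m (T - T0)) - (ln (\det T) - ln (\det T0)).
  exact: (loglik_loss T0pos Tpos LL l0).
have s20 : 0 <= sigma2_max T0.
  by apply: le_trans (diag_le_sigma2_max _ e.1);
    rewrite -LL -delta_qform -/(qform _ _) qform_gram fro2_ge0.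
pose W := [set e : 'I_p * 'I_p | [|| e.1 == e.2, adj E e.1 e.2 | adj E0 e.1 e.2]]%SET.
have cW : (#|W| <= p + 4 * q)%N.
  apply: leq_trans (card_support_le _ _) _; rewrite -addnA leq_add2l.
  rewrite (_ : 4 * q = 2 * q + 2 * q)%N; last by rewrite -mulnDl.
  by rewrite leq_add// leq_mul2l.
have score : \tr ((invmx T0 - S) *m (T - T0)) <= y / 16 * x.
  apply: le_trans (tr_score_le (W := W) _ _ Sb _) _.
  - by rewrite trmxB Tpos.1 T0pos.1.
  - by rewrite !mulr_ge0.
  - move=> j k; rewrite inE /= => /norP[jk /norP[jE jE0]].
    rewrite !mxE Tz//; have := pat.2 j k jk; rewrite (negbTE jE0) => /negbFE/eqP ->.
    by rewrite subrr.
  - have -> : fro (T - T0) = x * l by rewrite /x mulfVK ?gt_eqF.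
    have cWR : Num.sqrt #|W|%:R <= Num.sqrt (p + 4 * q)%:R :> R by rewrite ler_wsqrtr// ler_nat.
    have x0 : 0 <= x by lra.
    rewrite [leLHS](_ : _ = (2 * (sigma2_max T0 * l) * r * Num.sqrt #|W|%:R) * x); last by ring.
    rewrite ler_wpM2r//; apply: le_trans rq.
    by apply: ler_pM; rewrite ?sqrtr_ge0 ?mulr_ge0// ?(ltW l0)// ler_wpM2r// ler_pM2l.
(* Since [y <= x] and [y <= 1], y (1 + x) <= 2 x. The loss is thus at least twice the bound on the
   score, and what remains is at least y x / 16 >= y^2 / 16. *)
have xl : y / 8 * x <= x ^+ 2 / (4 * (1 + x)).
  rewrite ler_pdivlMr; last by lra.
  have -> : y / 8 * x * (4 * (1 + x)) = x * (y * (1 + x) / 2) by field.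
  by rewrite expr2 ler_wpM2l//; nra.
have gap : y ^+ 2 / 16 <= \tr (S *m (T - T0)) - (ln (\det T) - ln (\det T0)).
  move: score; rewrite mulmxBl linearB /= => score.
  have : y * y <= y * x by rewrite ler_wpM2l// ltW.
  lra.
rewrite /loglik -mulrBr.
have -> : n%:R * y ^+ 2 / 32 = n%:R / 2 * (y ^+ 2 / 16) by field.
rewrite ler_wpM2l// ?divr_ge0//; apply: le_trans gap _.
by rewrite mulmxBr linearB /=; lra.
Qed.

(** * Rates and the limit *)

Lemma cvg_one_sub_inv (R : realType) (p : nat -> nat) :
  ((fun n => (p n)%:R : R) @ \oo --> +oo) ->
  (fun n => (1 - 4 / (p n)%:R)%:E : \bar R) @ \oo --> 1%E.
Proof.
move=> py; apply: cvg_EFin; first exact: nearW.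
have pV : (fun n => ((p n)%:R : R)^-1) @ \oo --> (0 : R).
  apply/gtr0_cvgV0 => //.
  by move/cvgryPgt: py => /(_ 0).
rewrite -[X in _ --> X](subr0 1); apply: cvgB; first exact: cvg_cst.
rewrite -[X in _ --> X](mulr0 4); apply: cvgM => //; exact: cvg_cst.
Qed.

(* V is the quantity tending to 0 in (v), with y = theta_0 / lambda_max. *)
Lemma rate_conditions (R : realType) (p q n : nat) (y D g : R)
  (V := (p + 2 * q)%:R * ln p%:R * (y^-1 ^+ 2) / n%:R)
  (rho := Num.sqrt (3 * (ln p%:R / n%:R))) :
  0 <= D -> 0 <= g -> (0 < n)%N -> (1 < p)%N -> 0 < y <= 1 ->
  V * (6 * D ^+ 2 + 64 * (1 + g) + 12) < 1 ->
  [/\ 0 <= rho <= 2^-1, 3 * ln p%:R = n%:R * rho ^+ 2,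
      D * rho * Num.sqrt (p + 4 * q)%:R <= y &
      2 * q%:R * ln p%:R * (1 + g) < n%:R * y ^+ 2 / 32].
Proof.
move=> D0 g0 n0 p1 /andP[y0 y1] HV.
have n0R : (0 : R) < n%:R by rewrite ltr0n.
have lp : (0 : R) < ln p%:R by rewrite ln_gt0// ltr1n.
have ln0 : 0 < ln p%:R / n%:R :> R by rewrite divr_gt0.
(* W = V y^2 <= V. Each summand of the constant serves one bound: 12 V < 1 gives rho <= 1/2, 6 D^2 V
   < 1 the bound with D (as p + 4 q <= 2 (p + 2 q)), and 64 (1 + g) V < 1 the last one, as n y^2 /
   32 = W n / (32 V). *)
pose W := (p + 2 * q)%:R * (ln p%:R / n%:R) : R.
have pq1 : (1 : R) <= (p + 2 * q)%:R by rewrite ler1n addn_gt0 (ltn_trans _ p1).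
have W0 : 0 < W by rewrite mulr_gt0//; lra.
have WV : W = V * y ^+ 2 by rewrite /W /V; field; rewrite !gt_eqF.
have V0 : 0 < V by rewrite -(pmulr_lgt0 _ (exprn_gt0 2 y0)) -WV.
have D2 : 0 <= V * D ^+ 2 by rewrite mulr_ge0 ?sqr_ge0// ltW.
have Vg : 0 <= V * g by rewrite mulr_ge0// ltW.
have y21 : y ^+ 2 <= 1 by rewrite expr_le1// ltW.
have WleV : W <= V by rewrite WV ler_piMr// ltW.
have lW : ln p%:R / n%:R <= W by rewrite /W ler_peMl// ltW.
have r2 : rho ^+ 2 = 3 * (ln p%:R / n%:R).
  by apply: sqr_sqrtr; rewrite mulr_ge0// ltW.
have r0 : 0 <= rho := sqrtr_ge0 _.
clearbody rho; split.
- rewrite r0 /= -(@ler_pXn2r _ 2) ?nnegrE// r2 exprVn expr2; lra.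
- by rewrite r2; field; rewrite gt_eqF.
- rewrite -(@ler_pXn2r _ 2) ?nnegrE ?mulr_ge0 ?sqrtr_ge0//; last exact: ltW.
  rewrite !exprMn r2 sqr_sqrtr ?ler0n//.
  have pq : (p + 4 * q)%:R <= 2 * (p + 2 * q)%:R :> R.
    by rewrite -natrM ler_nat mulnDr mulnA leq_add// leq_pmull.
  have : ln p%:R / n%:R * (p + 4 * q)%:R <= 2 * W.
    have -> : 2 * W = ln p%:R / n%:R * (2 * (p + 2 * q)%:R) by rewrite /W; ring.
    by rewrite ler_wpM2l// ltW.
  move=> /(ler_wpM2l (sqr_ge0 D)) H.
  have H2 : 6 * D ^+ 2 * W <= y ^+ 2.
    have -> : 6 * D ^+ 2 * W = 6 * (V * D ^+ 2) * y ^+ 2 by rewrite WV; ring.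
    by rewrite -[leRHS]mul1r ler_wpM2r ?sqr_ge0//; lra.
  lra.
- have -> : n%:R * y ^+ 2 / 32 = W * n%:R * (V^-1 / 32).
    by rewrite WV; field; rewrite gt_eqF.
  have q2 : 2 * q%:R * ln p%:R <= W * n%:R.
    rewrite /W mulrA mulfVK ?gt_eqF// -natrM; apply: ler_wpM2r; first exact: ltW.
    by rewrite ler_nat leq_addl.
  apply: (@le_lt_trans _ _ (W * n%:R * (1 + g))); first by rewrite ler_wpM2r//; lra.
  have g1 : 1 + g < V^-1 / 32.
    rewrite ltr_pdivlMr// -[V^-1]mul1r ltr_pdivlMr//; lra.
  by rewrite ltr_pM2l// mulr_gt0.
Qed.

Lemma invmx_diag_gt0 (R : realType) (p : nat) (T L : 'M[R]_p) j :
  posdef T -> L *m L^T = invmx T -> 0 < (invmx T) j j.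
Proof.
move=> Tpos LL.
have := unitmx_inv T; rewrite (posdef_unit Tpos) -LL unitmx_mul => /andP[_ Lu].
rewrite -delta_qform -/(qform _ _) qform_gram; apply: fro2_gt0.
apply/eqP => /(congr1 (mulmx (invmx L^T))); rewrite mulKmx// mulmx0.
by move=> /matrixP /(_ j ord0) /eqP; rewrite !mxE !eqxx oner_eq0.
Qed.

Lemma selection_event (R : realType) (d : measure_display) (Omega : measurableType d)
  (P : probability Omega R) (Z : nat * nat -> Omega -> R) (p q n : nat)
  (E0 : {set 'I_p * 'I_p}) (T0 L : 'M[R]_p) (C g : R)
  (S := fun w => sample_cov (fun i : 'I_n => sample L Z w i)) :
  iid_std_normal P Z -> posdef T0 -> exact_pattern T0 E0 -> L *m L^T = invmx T0 ->
  0 <= C -> 0 <= g -> (0 < n)%N -> (1 < p)%N ->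
  is_edge_set E0 -> (#|E0| <= q)%N ->
  sigma2_max T0 * lambda_max T0 <= C ->
  (p + 2 * q)%:R * ln p%:R * (lambda_max T0 ^+ 2 / theta_min T0 E0 ^+ 2) / n%:R *
    (6 * (16 * (16 * C)) ^+ 2 + 64 * (1 + g) + 12) < 1 ->
  exists A : set Omega, [/\ measurable A,
    (forall w, A w -> forall E : {set 'I_p * 'I_p},
       is_edge_set E -> ~~ (E0 \subset E) -> (#|E| <= q)%N ->
       ((loglik n (S w) T0)%:E - max_loglik n (S w) E > (2 * q%:R * ln p%:R * (1 + g))%:E)%E) &
    ((1 - 4 / p%:R)%:E <= P A)%E].
Proof.
move=> iidZ T0pos pat LL C0 g0 n0 p1 eE0 cE0 sl HV.
(* For empty [E0] no competing [E] exists and the whole space works; otherwise an edge makes theta_0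
   positive. *)
have [E00|[e eE0']] := set_0Vmem E0.
  exists setT; split => //; first by move=> w _ E _; rewrite E00 finset.sub0set.
  by rewrite probability_setT lee_fin gerBl divr_ge0.
have p0 : (0 < p)%N by exact: ltn_trans p1.
set l := lambda_max T0 in sl HV *; set th := theta_min T0 E0 in HV *.
have /andP[th0 thl] : 0 < th <= l by exact: theta_min_bounds eE0'.
have l0 : 0 < l := lambda_max_gt0 e.1 T0pos.
have y01 : 0 < th / l <= 1 by rewrite divr_gt0//= ler_pdivrMr// mul1r.
(* With [r = 8 * rho], the condition 2 C r sqrt (p + 4 q) <= y / 16 of [loglik_gap] reads 256 C rho
   sqrt (p + 4 q) <= y. *)
have D0 : 0 <= 16 * (16 * C) by rewrite !mulr_ge0.
have [] := rate_conditions (q := q) D0 g0 n0 p1 y01.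
  by rewrite invf_div expr_div_n.
set rho := Num.sqrt _ => /andP[rho0 rho1] rho2 c2 c1; clearbody rho.
(* The factor 8 cancels the 64 of the tail bound, so that n r^2 / 64 is exactly 3 ln p, and
   [rho <= 2^-1] becomes [r <= 4]. *)
pose r := 8 * rho.
have r04 : 0 <= r <= 4 by rewrite /r; apply/andP; split; lra.
have r2 : 3 * ln p%:R <= n%:R * r ^+ 2 / 64.
  by rewrite rho2 le_eqVlt; apply/orP; left; apply/eqP; rewrite /r; field.
have s20 : 0 < sigma2_max T0.
  exact: lt_le_trans (invmx_diag_gt0 e.1 T0pos LL) (diag_le_sigma2_max _ _).
have Ls j : (L *m L^T) j j <= sigma2_max T0 by rewrite LL; exact: diag_le_sigma2_max.
have [A [mA Ab PA]] := sample_cov_uniform iidZ n0 p0 s20 Ls r04 r2.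
exists A; split=> // w Aw E eE EE0 cE.
have gap T : in_model E T -> n%:R * (th / l) ^+ 2 / 32 <= loglik n (S w) T0 - loglik n (S w) T.
  apply: (@loglik_gap R p q n E0 E T0 L (S w) T C r T0pos pat LL eE0 cE0 eE EE0 cE sl).
  - by case/andP: r04.
  - by move=> j k; rewrite -LL; exact: Ab.
  - move: c2; set X := Num.sqrt _ => c2.
    by rewrite ler_pdivlMr// (_ : _ * 16 = 16 * (16 * C) * rho * X)// /r; ring.
have maxle : (max_loglik n (S w) E <= (loglik n (S w) T0 - n%:R * (th / l) ^+ 2 / 32)%:E)%E.
  by apply: ge_ereal_sup => _ [T /gap TE <-]; rewrite lee_fin; lra.
apply: (@lt_le_trans _ _ (n%:R * (th / l) ^+ 2 / 32)%:E); first by rewrite lte_fin.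
have := @leeB _ _ _ _ _ (lexx (loglik n (S w) T0)%:E) maxle.
by rewrite -EFinB opprB addrC subrK.
Qed.

Theorem theorem1 (R : realType) (d : measure_display) (Omega : measurableType d)
  (P : probability Omega R) (Z : nat * nat -> Omega -> R)
  (p q : nat -> nat)
  (E0 : forall n, {set 'I_(p n) * 'I_(p n)})
  (Theta0 : forall n, 'M[R]_(p n))
  (L : forall n, 'M[R]_(p n))
  (C kappa gamma : R) :
  iid_std_normal P Z ->
  (forall n, posdef (Theta0 n) /\ exact_pattern (Theta0 n) (E0 n)) ->
  (forall n, L n *m (L n)^T = invmx (Theta0 n)) ->
  0 < C -> 0 < kappa ->
  (* (i) *)
  (forall n, [/\ is_edge_set (E0 n), decomposable (E0 n) & (#|E0 n| <= q n)%N]) ->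
  (* (ii) *)
  (forall n, sigma2_max (Theta0 n) * lambda_max (Theta0 n) <= C) ->
  (* (iii) *)
  (exists K : R, \forall n \near \oo, (p n)%:R <= K * (n%:R `^ kappa)) ->
  ((fun n => (p n)%:R : R) @ \oo --> +oo) ->
  (* (iv) *)
  0 < gamma - (1 - (4 * kappa)^-1) ->
  (* (v) *)
  ((fun n => ((p n + 2 * q n)%:R * ln (p n)%:R *
               (lambda_max (Theta0 n) ^+ 2 / theta_min (Theta0 n) (E0 n) ^+ 2))
              / n%:R) @ \oo --> (0 : R)) ->
  exists A : nat -> set Omega,
    (forall n,
       measurable (A n) /\
       A n `<=`
       [set w | forall E : {set 'I_(p n) * 'I_(p n)},
          is_edge_set E -> ~~ (E0 n \subset E) -> (#|E| <= q n)%N ->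
          ((loglik n (sample_cov (fun i : 'I_n => sample (L n) Z w i)) (Theta0 n))%:E
             - max_loglik n (sample_cov (fun i : 'I_n => sample (L n) Z w i)) E
           > (2 * (q n)%:R * ln (p n)%:R * (1 + (gamma - (1 - (4 * kappa)^-1))))%:E)%E]) /\
    ((fun n => P (A n)) @ \oo --> 1%E).

Proof.
move=> iidZ T0P LL C0 kappa0 iP iiP _ py g0 vV.
set g := gamma - _ in g0 *.
pose M := 6 * (16 * (16 * C)) ^+ 2 + 64 * (1 + g) + 12.
have M0 : 0 < M by rewrite /M; have := sqr_ge0 (16 * (16 * C)); lra.
pose V n := (p n + 2 * q n)%:R * ln (p n)%:R *
  (lambda_max (Theta0 n) ^+ 2 / theta_min (Theta0 n) (E0 n) ^+ 2) / n%:R.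
pose good n := [/\ (0 < n)%N, (1 < p n)%N & V n * M < 1].
have goodn : \forall n \near \oo, good n.
  have V1 : \forall n \near \oo, V n < M^-1.
    have := cvgr_lt _ vV _ (_ : 0 < M^-1); apply; by rewrite invr_gt0.
  near=> n; split.
  - near: n; exact: nbhs_infty_gt.
  - rewrite -(ltr1n R); near: n; by move/cvgryPgt: py => /(_ 1).
  - rewrite -ltr_pdivlMr// mul1r; near: n; exact: V1.
have /choice[A AP] : forall n, exists A : set Omega,
    (measurable A /\ A `<=` [set w | forall E : {set 'I_(p n) * 'I_(p n)},
          is_edge_set E -> ~~ (E0 n \subset E) -> (#|E| <= q n)%N ->
          ((loglik n (sample_cov (fun i : 'I_n => sample (L n) Z w i)) (Theta0 n))%:E
             - max_loglik n (sample_cov (fun i : 'I_n => sample (L n) Z w i)) E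
           > (2 * (q n)%:R * ln (p n)%:R * (1 + g))%:E)%E]) /\
    (good n -> ((1 - 4 / (p n)%:R)%:E <= P A)%E).
  move=> n; have [[n0 p1 VM]|ngood] := pselect (good n); last first.
    (* The empty event satisfies the inclusion trivially; it is used for finitely many n only, so
       the limit is unaffected. *)
    by exists set0; split=> //; split=> // w.
  have [T0pos pat] := T0P n; have [eE0 _ cE0] := iP n.
  have [A [mA AS PA]] := selection_event iidZ T0pos pat (LL n) (ltW C0) (ltW g0) n0 p1 eE0 cE0 (iiP n) VM.
  by exists A; split.
exists A; split=> [n|]; first exact: (AP n).1.
apply: (@squeeze_cvge _ _ _ _ (fun n => (1 - 4 / (p n)%:R)%:E) _ (fun=> 1%E)).
- near=> n; apply/andP; split; last by apply: probability_le1; exact: (AP n).1.1.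
  by apply: (AP n).2; near: n; exact: goodn.
- exact: cvg_one_sub_inv.
- exact: cvg_cst.
Unshelve. all: by end_near.
Qed.
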